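(* Let $\omega\in\mathbb{C}^*$ and let $F$ be a meromorphic function on $\mathbb{C}$ with a pole at $\omega$ and no other poles. Assume that $F$, viewed as a germ at the origin, has a Hadamard inverse $G=F^{\odot -1}\in\mathbb{C}\{\zeta\}$, i.e. $F\odot G=\frac{1}{1-\zeta}$. Then $G$ satisfies a linear non-homogeneous ordinary differential equation whose singular points belong to $\{0,\omega^{-1}\}$. Consequently $G$ is $\{0,\omega^{-1}\}$-continuable, i.e. $G$ is a resurgent germ whose only possible singular points, on all sheets of its analytic continuation, are $0$ and $\omega^{-1}$.
   Context: $\mathbb{C}\{\zeta\}$ is the space of holomorphic germs at the origin (convergent power series). The Hadamard product is $\left(\sum_{n\ge0}a_n\zeta^n\right)\odot\left(\sum_{n\ge0}b_n\zeta^n\right)=\sum_{n\ge0}a_nb_n\zeta^n$; its unit is $\delta=\frac{1}{1-\zeta}$. A Hadamard inverse $F^{\odot-1}$ of $F\in\mathbb{C}\{\zeta\}$ is a germ $G\in\mathbb{C}\{\zeta\}$ with $F\odot G=\delta$. For a non-empty closed discrete subset $\Omega\subset\mathbb{C}$, a germ $f\in\mathbb{C}\{\zeta\}$ is called $\Omega$-continuable if it admits analytic continuation along any path of $\mathbb{C}\setminus\Omega$ that starts in the disc of convergence of $f$; $f$ is called resurgent if it is $\Omega$-continuable for some such $\Omega$. A linear ordinary differential equation $\sum_{j=0}^{m}p_j(\zeta)\partial_\zeta^jG=r(\zeta)$ (order $m\ge0$) has its singular points in a set $S$ if $p_0,\dots,p_m,r$ are holomorphic on $\mathbb{C}\setminus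 S$ and $p_m$ has no zeros on $\mathbb{C}\setminus S$. *)

(* Defs.v *)
From Stdlib Require Export Reals.
From Coquelicot Require Export Coquelicot.

Open Scope C_scope.

Definition holomorphic_on (U : C -> Prop) (f : C -> C) : Prop :=
  forall z : C, U z -> @ex_derive C_AbsRing C_NormedModule f z.

Definition holomorphic_at (f : C -> C) (z : C) : Prop :=
  locally z (fun y : C => @ex_derive C_AbsRing C_NormedModule f y).

(* The value of [f] at the pole itself is irrelevant. *)
Definition pole (f : C -> C) (z : C) : Prop :=
  exists (k : nat) (h : C -> C),
    (1 <= k)%nat /\ holomorphic_at h z /\ h z <> 0 /\
    locally' z (fun y : C => f y = h y / (y - z) ^ k).

Definition meromorphic (f : C -> C) : Prop :=
  forall z : C, holomorphic_at f z \/ pole f z.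

(* A germ at the origin is represented by its sequence of Taylor
   coefficients. *)
Definition germ_radius (a : nat -> C) : Rbar :=
  CV_radius (fun n : nat => Cmod (a n)).

Definition convergent_germ (a : nat -> C) : Prop :=
  Rbar_lt (Finite 0) (germ_radius a).

Definition convergence_disc (a : nat -> C) (z : C) : Prop :=
  Rbar_lt (Finite (Cmod z)) (germ_radius a).

(* Meaningful on [convergence_disc a]. *)
Definition germ_sum (a : nat -> C) (z : C) : C :=
  (Series (fun n : nat => Re (a n * z ^ n)),
   Series (fun n : nat => Im (a n * z ^ n))).

Definition germ_of (f : C -> C) (a : nat -> C) : Prop :=
  convergent_germ a /\ locally (RtoC 0) (fun z : C => f z = germ_sum a z).

Definition hadamard (a b : nat -> C) (n : nat) : C := a n * b n.

Definition hadamard_inverse (a b : nat -> C) : Prop :=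
  convergent_germ b /\ germ_of (fun z : C => 1 / (1 - z)) (hadamard a b).

(* sum_(j <= ode_order) ode_coef j * G^(j) = ode_rhs; the values of the
   functions on the singular set are irrelevant. *)
Record linear_ode : Type := LinearODE {
  ode_order : nat;
  ode_coef : nat -> C -> C;
  ode_rhs : C -> C
}.

Definition ode_singular_points_in (E : linear_ode) (S : C -> Prop) : Prop :=
  (forall j : nat, (j <= ode_order E)%nat ->
     holomorphic_on (fun z : C => ~ S z) (ode_coef E j)) /\
  holomorphic_on (fun z : C => ~ S z) (ode_rhs E) /\
  (forall z : C, ~ S z -> ode_coef E (ode_order E) z <> 0).

Definition ode_nonhomogeneous (E : linear_ode) (S : C -> Prop) : Prop :=
  exists z : C, ~ S z /\ ode_rhs E z <> 0.

Definition germ_solves (E : linear_ode) (S : C -> Prop) (b : nat -> C) : Prop :=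
  forall z : C, convergence_disc b z -> ~ S z ->
    @sum_n C_AbelianMonoid
      (fun j : nat => ode_coef E j z * Nat.iter j C_derive (germ_sum b) z)
      (ode_order E)
    = ode_rhs E z.

Definition unit_interval (t : R) : Prop := (0 <= t <= 1)%R.

(* [phi t] represents the germ at [gamma t] of the continuation; nearby germs
   of the family are restrictions of one another. *)
Definition continues_along (gamma : R -> C) (b : nat -> C) : Prop :=
  exists phi : R -> C -> C,
    (forall t : R, unit_interval t -> holomorphic_at (phi t) (gamma t)) /\
    locally (gamma 0%R) (fun z : C => phi 0%R z = germ_sum b z) /\
    (forall t : R, unit_interval t ->
       within unit_interval (locally t) (fun s : R =>
         locally (gamma s) (fun z : C => phi s z = phi t z))).

Definition nonempty_closed_discrete (Omega : C -> Prop) : Prop :=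
  (exists z : C, Omega z) /\ closed Omega /\
  (forall z : C, Omega z -> locally' z (fun y : C => ~ Omega y)).

Definition continuable (Omega : C -> Prop) (b : nat -> C) : Prop :=
  nonempty_closed_discrete Omega /\ convergent_germ b /\
  forall gamma : R -> C,
    continuous_on unit_interval gamma ->
    (forall t : R, unit_interval t -> ~ Omega (gamma t)) ->
    convergence_disc b (gamma 0%R) ->
    continues_along gamma b.

Definition resurgent (b : nat -> C) : Prop :=
  exists Omega : C -> Prop, continuable Omega b.

(* Main.v *)
Require Import Defs.
From Stdlib Require Import Reals Lra Lia Classical ClassicalEpsilon.
From Coquelicot Require Import Coquelicot.

Open Scope C_scope.

(** Rescaling the variable moves the pole to [1]: the function [F (w z)] has the
    coefficients [a_n w^n], and [(1 - z)^k F (w z)] is entire, [k] being the order of the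
    pole. On coefficients, multiplication by [1 - z] is the backward difference, so the
    [k]-th iterated difference of [a_n w^n] decays faster than every geometric sequence.
    Summing back [k] times, where each summation turns a rapidly decaying sequence into a
    constant plus a rapidly decaying one and raises degrees by one, gives
    [a_n w^n = Q(n) + e_n] with [Q] a polynomial of degree exactly [m = k - 1] and [e] the
    coefficients of an entire function ([pole_coefficients]).

    Since [a_n b_n = 1], it follows that [Q(n) b_n + e_n b_n = w^n]
    ([hadamard_inverse_coefficients]). Expand [Q] in falling factorials with coefficients
    [q_j]. As [n (n - 1) ... (n - j + 1) b_n] are the coefficients of [z^j G^(j)], this is
    the Euler equation

      [sum_(j <= m) q_j z^j G^(j)(z) = 1 / (1 - w z) - H(z)],

    where [H], the sum of [e_n b_n z^n], is entire because [b] grows at most geometrically.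
    The leading coefficient [q_m z^m] vanishes only at [0], and the right-hand side is
    singular only at [/ w], where it has a pole and hence does not vanish identically.

    For the continuation, the functions [Y_j = z^j G^(j)] with [j < m] satisfy a system
    [z Y' = A Y + V] with a constant matrix [A]. Around a point other than [0] and [/ w]
    the Taylor coefficients of a solution obey a recurrence of length two, which bounds
    them geometrically and determines them from the initial value. Thus germs of
    solutions extend uniquely to discs whose radius is bounded below locally
    ([euler_germ_extension]), and such germs continue along every path
    ([continuation_along_path]). For [m = 0] the equation itself expresses [G] as a
    function holomorphic off [/ w].

    The function theory behind this is that a complex differentiable function on a disc
    is the sum of a power series on a smaller disc ([power_series_disc]), and on the whole
    plane if it is entire ([power_series_entire]). It comes from Goursat's theorem for
    rectangles and Cauchy's formula on squares. Squares lose a constant factor in the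
    radius, which is harmless here: entire functions live on squares of all sizes, and
    continuation needs only discs of locally uniform size. *)

(** * Neighbourhoods in the complex plane *)

Definition near (z : C) (P : C -> Prop) : Prop :=
  exists d : R, (0 < d)%R /\ forall y : C, (Cmod (y - z) < d)%R -> P y.

(** The neighbourhoods of [C_UniformSpace] are those of the product [R * R]; discs for
    the modulus generate the same filter. *)
Lemma near_locally (z : C) (P : C -> Prop) :
  near z P <-> @locally C_UniformSpace z P.
Proof.
  split.
  - intros [d [Hd H]]. apply locally_C. exists (mkposreal d Hd). intros y Hy.
    apply H. exact Hy.
  - intros H. apply locally_C in H. destruct H as [e He].
    exists (pos e). split. apply cond_pos. intros y Hy. apply He. exact Hy.
Qed.

Lemma near_and (z : C) (P Q : C -> Prop) :
  near z P -> near z Q -> near z (fun y => P y /\ Q y).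
Proof.
  intros [d [Hd H]] [e [He H']]. exists (Rmin d e). split.
  - now apply Rmin_glb_lt.
  - intros y Hy. split; [apply H|apply H']; eapply Rlt_le_trans; try exact Hy.
    apply Rmin_l. apply Rmin_r.
Qed.

Lemma near_imp (z : C) (P Q : C -> Prop) :
  (forall y, P y -> Q y) -> near z P -> near z Q.
Proof. intros HPQ [d [Hd H]]. exists d. split; auto. Qed.

Lemma near_self (z : C) (P : C -> Prop) : near z P -> P z.
Proof.
  intros [d [Hd H]]. apply H. replace (z - z) with (RtoC 0) by ring.
  now rewrite Cmod_0.
Qed.

Lemma near_ball (z0 z : C) (r : R) :
  (Cmod (z - z0) < r)%R -> near z (fun y => (Cmod (y - z0) < r)%R).
Proof.
  intros H. exists (r - Cmod (z - z0))%R. split. lra. intros y Hy.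
  replace (y - z0) with ((y - z) + (z - z0)) by ring.
  eapply Rle_lt_trans. apply Cmod_triangle. lra.
Qed.

Lemma near_near (z : C) (P : C -> Prop) : near z P -> near z (fun y => near y P).
Proof.
  intros [d [Hd H]]. exists d. split; auto. intros y Hy.
  apply near_imp with (2 := near_ball _ _ _ Hy). exact H.
Qed.

Lemma near_neq (z p : C) : z <> p -> near z (fun y => y <> p).
Proof.
  intros H. exists (Cmod (z - p)). split.
  - apply Cmod_gt_0. intros E. apply H. replace z with ((z - p) + p) by ring. rewrite E. ring.
  - intros y Hy E. subst y. replace (p - z) with (- (z - p)) in Hy by ring.
    rewrite Cmod_opp in Hy. lra.
Qed.

Lemma Cminus_eq0 (x y : C) : x - y = 0 -> x = y.
Proof. intros H. replace x with ((x - y) + y) by ring. rewrite H. ring. Qed.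

Lemma Cminus_neq0 (x y : C) : x <> y -> x - y <> 0.
Proof. intros H E. apply H. now apply Cminus_eq0. Qed.

Lemma Cmod_minus_sym (x y : C) : Cmod (x - y) = Cmod (y - x).
Proof. rewrite <- Cmod_opp. f_equal. ring. Qed.

Lemma Cmod_triangle_minus (x y : C) : (Cmod (x - y) <= Cmod x + Cmod y)%R.
Proof. unfold Cminus. rewrite <- (Cmod_opp y). apply Cmod_triangle. Qed.

Lemma Cmod_rev (x y : C) : (Cmod x - Cmod y <= Cmod (x - y))%R.
Proof.
  replace x with ((x - y) + y) at 1 by ring. pose proof (Cmod_triangle (x - y) y). lra.
Qed.

(** * Continuity and complex derivatives *)

Definition ccont (f : C -> C) (z : C) : Prop :=
  forall eps : R, (0 < eps)%R -> near z (fun y => (Cmod (f y - f z) < eps)%R).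

Definition cder (f : C -> C) (z l : C) : Prop :=
  forall eps : R, (0 < eps)%R ->
    near z (fun y => (Cmod (f y - f z - (y - z) * l) <= eps * Cmod (y - z))%R).

Definition cdiff (f : C -> C) (z : C) : Prop := exists l : C, cder f z l.

(** The epsilon-delta form has a single notion of neighbourhood, whereas [is_derive] uses
    that of the absolute ring on the source and that of the normed module on the target. *)
Lemma is_derive_cder (f : C -> C) (z l : C) :
  @is_derive C_AbsRing C_NormedModule f z l <-> cder f z l.
Proof.
  split.
  - intros [_ H] eps He. specialize (H z (fun P HP => HP) (mkposreal eps He)).
    apply near_locally. apply locally_C. exact H.
  - intros H. split.
    + apply is_linear_scal_l.
    + intros x Hx. pose proof (is_filter_lim_locally_unique _ _ Hx) as E.
      subst x. intros eps. specialize (H eps (cond_pos eps)).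
      apply near_locally in H. apply locally_C in H. exact H.
Qed.

Lemma ex_derive_cdiff (f : C -> C) (z : C) :
  @ex_derive C_AbsRing C_NormedModule f z <-> cdiff f z.
Proof. split; intros [l H]; exists l; now apply is_derive_cder. Qed.

Lemma C_derive_cder (f : C -> C) (z l : C) : cder f z l -> C_derive f z = l.
Proof. intros H. apply is_C_derive_unique. now apply is_derive_cder. Qed.

Lemma ccont_ext_near (f g : C -> C) (z : C) :
  near z (fun y => f y = g y) -> ccont f z -> ccont g z.
Proof.
  intros H Hf eps He. rewrite <- (near_self _ _ H).
  apply near_imp with (2 := near_and _ _ _ H (Hf eps He)).
  intros y [<- Hy]. exact Hy.
Qed.

Lemma cder_ext_near (f g : C -> C) (z l : C) :
  near z (fun y => f y = g y) -> cder f z l -> cder g z l.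
Proof.
  intros H Hf eps He. rewrite <- (near_self _ _ H).
  apply near_imp with (2 := near_and _ _ _ H (Hf eps He)).
  intros y [<- Hy]. exact Hy.
Qed.

Lemma cdiff_ext_near (f g : C -> C) (z : C) :
  near z (fun y => f y = g y) -> cdiff f z -> cdiff g z.
Proof. intros H [l Hl]. exists l. now apply cder_ext_near with f. Qed.

Lemma ccont_const (c z : C) : ccont (fun _ => c) z.
Proof.
  intros eps He. exists 1%R. split. lra. intros y _.
  replace (c - c) with (RtoC 0) by ring. now rewrite Cmod_0.
Qed.

Lemma ccont_id (z : C) : ccont (fun y => y) z.
Proof. intros eps He. exists eps. auto. Qed.

Lemma ccont_plus (f g : C -> C) (z : C) :
  ccont f z -> ccont g z -> ccont (fun y => f y + g y) z.
Proof.
  intros Hf Hg eps He.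
  apply near_imp with (2 := near_and _ _ _ (Hf (eps/2)%R ltac:(lra)) (Hg (eps/2)%R ltac:(lra))).
  intros y [H1 H2].
  replace (f y + g y - (f z + g z)) with ((f y - f z) + (g y - g z)) by ring.
  eapply Rle_lt_trans. apply Cmod_triangle. lra.
Qed.

Lemma ccont_mult (f g : C -> C) (z : C) :
  ccont f z -> ccont g z -> ccont (fun y => f y * g y) z.
Proof.
  intros Hf Hg eps He.
  set (A := (1 + Cmod (f z) + Cmod (g z))%R).
  pose proof (Cmod_ge_0 (f z)). pose proof (Cmod_ge_0 (g z)).
  assert (HA : (0 < A)%R) by (unfold A; lra).
  set (e := Rmin 1 (eps / (2 * A))%R).
  assert (He' : (0 < e)%R).
  { apply Rmin_glb_lt. lra. apply Rdiv_lt_0_compat; lra. }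
  apply near_imp with (2 := near_and _ _ _ (Hf e He') (Hg e He')).
  intros y [H1 H2].
  replace (f y * g y - f z * g z)
    with ((f y - f z) * (g y - g z) + (f z * (g y - g z) + (f y - f z) * g z)) by ring.
  eapply Rle_lt_trans. apply Cmod_triangle.
  eapply Rle_lt_trans. apply Rplus_le_compat_l. apply Cmod_triangle.
  rewrite !Cmod_mult.
  assert (e <= 1)%R by apply Rmin_l.
  assert (e * A <= eps / 2)%R.
  { apply Rle_trans with (eps / (2 * A) * A)%R. apply Rmult_le_compat_r. lra. apply Rmin_r.
    right. field. lra. }
  pose proof (Cmod_ge_0 (f y - f z)). pose proof (Cmod_ge_0 (g y - g z)).
  assert (Cmod (f y - f z) * Cmod (g y - g z) <= e * 1)%R by nra.
  assert (Cmod (f z) * Cmod (g y - g z) <= Cmod (f z) * e)%R by nra.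
  assert (Cmod (f y - f z) * Cmod (g z) <= e * Cmod (g z))%R by nra.
  unfold A in *. nra.
Qed.

Lemma ccont_comp (f g : C -> C) (z : C) :
  ccont f z -> ccont g (f z) -> ccont (fun y => g (f y)) z.
Proof.
  intros Hf Hg eps He. destruct (Hg eps He) as [d [Hd H]].
  apply near_imp with (2 := Hf d Hd). intros y Hy. now apply H.
Qed.

Lemma ccont_inv (z : C) : z <> 0 -> ccont Cinv z.
Proof.
  intros Hz eps He.
  assert (Hm : (0 < Cmod z)%R) by now apply Cmod_gt_0.
  exists (Rmin (Cmod z / 2) (eps * (Cmod z * Cmod z / 2)))%R. split.
  { apply Rmin_glb_lt. lra. apply Rmult_lt_0_compat. lra. nra. }
  intros y Hy.
  assert (H1 : (Cmod (y - z) < Cmod z / 2)%R) by (eapply Rlt_le_trans; [exact Hy|apply Rmin_l]).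
  assert (H2 : (Cmod (y - z) < eps * (Cmod z * Cmod z / 2))%R) by (eapply Rlt_le_trans; [exact Hy|apply Rmin_r]).
  assert (H3 : (Cmod z / 2 < Cmod y)%R).
  { pose proof (Cmod_rev z y). rewrite Cmod_minus_sym in H. lra. }
  assert (Hy0 : y <> 0). { apply Cmod_gt_0. lra. }
  replace (/ y - / z) with (- ((y - z) / (y * z))) by now field.
  rewrite Cmod_opp, Cmod_div, Cmod_mult by now apply Cmult_neq_0.
  apply Rlt_div_l. apply Rmult_lt_0_compat; lra.
  eapply Rlt_trans. exact H2. apply Rmult_lt_compat_l. exact He. nra.
Qed.

(** Caratheodory's form of differentiability: the difference quotient extends
    continuously. It turns the product, chain and inverse rules into statements on
    continuous functions. *)
Lemma cder_carath (f : C -> C) (z l : C) :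
  cder f z l <->
  exists q : C -> C, (forall y, f y - f z = (y - z) * q y) /\ q z = l /\ ccont q z.
Proof.
  split.
  - intros H.
    exists (fun y => if Ceq_dec y z then l else (f y - f z) / (y - z)).
    split; [|split].
    + intros y. destruct (Ceq_dec y z) as [->|n]. ring. field. now apply Cminus_neq0.
    + destruct (Ceq_dec z z); congruence.
    + intros eps He. destruct (Ceq_dec z z) as [_|]; [|congruence].
      apply near_imp with (2 := H (eps/2)%R ltac:(lra)). intros y Hy.
      destruct (Ceq_dec y z) as [->|n].
      * replace (l - l) with (RtoC 0) by ring. now rewrite Cmod_0.
      * pose proof (Cminus_neq0 _ _ n) as n'.
        replace ((f y - f z) / (y - z) - l) with ((f y - f z - (y - z) * l) / (y - z))
          by now field.
        rewrite Cmod_div by easy. apply Rle_lt_trans with (eps/2)%R; [|lra].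
        apply Rle_div_l. now apply Cmod_gt_0. exact Hy.
  - intros [q [Hq [<- Hc]]] eps He. apply near_imp with (2 := Hc eps He).
    intros y Hy. rewrite Hq.
    replace ((y - z) * q y - (y - z) * q z) with ((q y - q z) * (y - z)) by ring.
    rewrite Cmod_mult. apply Rmult_le_compat_r. apply Cmod_ge_0. lra.
Qed.

Lemma cder_ccont (f : C -> C) (z l : C) : cder f z l -> ccont f z.
Proof.
  intros H. apply cder_carath in H. destruct H as [q [Hq [_ Hc]]].
  apply (ccont_ext_near (fun y => f z + (y + - z) * q y)).
  - exists 1%R. split. lra. intros y _. unfold Cminus in Hq. rewrite <- Hq. ring.
  - apply ccont_plus. apply ccont_const. apply ccont_mult; [|easy].
    apply ccont_plus. apply ccont_id. apply ccont_const.
Qed.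

Lemma cdiff_ccont (f : C -> C) (z : C) : cdiff f z -> ccont f z.
Proof. intros [l H]. now apply cder_ccont with l. Qed.

Lemma cder_const (c z : C) : cder (fun _ => c) z 0.
Proof.
  apply cder_carath. exists (fun _ => RtoC 0). split; [|split]. intros; ring. easy.
  apply ccont_const.
Qed.

Lemma cder_id (z : C) : cder (fun y => y) z 1.
Proof.
  apply cder_carath. exists (fun _ => RtoC 1). split; [|split]. intros; ring. easy.
  apply ccont_const.
Qed.

Lemma cder_plus (f g : C -> C) (z l m : C) :
  cder f z l -> cder g z m -> cder (fun y => f y + g y) z (l + m).
Proof.
  intros Hf Hg. apply cder_carath in Hf. apply cder_carath in Hg. apply cder_carath.
  destruct Hf as [p [Hp [<- Cp]]]. destruct Hg as [q [Hq [<- Cq]]].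
  exists (fun y => p y + q y). split; [|split].
  - intros y. replace (f y + g y - (f z + g z)) with ((f y - f z) + (g y - g z)) by ring.
    rewrite Hp, Hq. ring.
  - easy.
  - now apply ccont_plus.
Qed.

Lemma cder_mult (f g : C -> C) (z l m : C) :
  cder f z l -> cder g z m -> cder (fun y => f y * g y) z (l * g z + f z * m).
Proof.
  intros Hf Hg. pose proof (cder_ccont _ _ _ Hg) as Cg.
  apply cder_carath in Hf. apply cder_carath in Hg. apply cder_carath.
  destruct Hf as [p [Hp [<- Cp]]]. destruct Hg as [q [Hq [<- Cq]]].
  exists (fun y => p y * g y + f z * q y). split; [|split].
  - intros y. replace (f y * g y - f z * g z) with ((f y - f z) * g y + f z * (g y - g z)) by ring.
    rewrite Hp, Hq. ring.
  - easy.
  - apply ccont_plus; apply ccont_mult; auto. apply ccont_const.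
Qed.

Lemma cder_comp (f g : C -> C) (z l m : C) :
  cder f z l -> cder g (f z) m -> cder (fun y => g (f y)) z (m * l).
Proof.
  intros Hf Hg. pose proof (cder_ccont _ _ _ Hf) as Cf.
  apply cder_carath in Hf. apply cder_carath in Hg. apply cder_carath.
  destruct Hf as [p [Hp [<- Cp]]]. destruct Hg as [q [Hq [<- Cq]]].
  exists (fun y => q (f y) * p y). split; [|split].
  - intros y. rewrite Hq, Hp. ring.
  - easy.
  - apply ccont_mult; auto. now apply ccont_comp.
Qed.

Lemma cder_inv (z : C) : z <> 0 -> cder Cinv z (- / (z * z)).
Proof.
  intros Hz.
  apply cder_ext_near with (fun y => if Ceq_dec y 0 then / z + (y - z) * (- / (z * z)) else / y).
  { apply near_imp with (2 := near_neq _ _ Hz). intros y Hy.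
    destruct (Ceq_dec y 0); congruence. }
  apply cder_carath.
  exists (fun y => if Ceq_dec y 0 then - / (z * z) else - (/ z * / y)). split; [|split].
  - intros y. destruct (Ceq_dec z 0); [congruence|].
    destruct (Ceq_dec y 0) as [->|Hy]. ring. now field.
  - destruct (Ceq_dec z 0); [congruence|]. now field.
  - apply ccont_ext_near with (fun y => - / z * / y).
    + apply near_imp with (2 := near_neq _ _ Hz). intros y Hy.
      destruct (Ceq_dec y 0); [congruence|]. ring.
    + apply ccont_mult. apply ccont_const. now apply ccont_inv.
Qed.

Lemma cder_eq (f : C -> C) (z l m : C) : cder f z l -> l = m -> cder f z m.
Proof. now intros H <-. Qed.

Lemma cdiff_const (c z : C) : cdiff (fun _ => c) z.
Proof. eexists. apply cder_const. Qed.

Lemma cdiff_id (z : C) : cdiff (fun y => y) z.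
Proof. eexists. apply cder_id. Qed.

Lemma cdiff_plus (f g : C -> C) (z : C) :
  cdiff f z -> cdiff g z -> cdiff (fun y => f y + g y) z.
Proof. intros [l Hl] [m Hm]. eexists. apply cder_plus; eassumption. Qed.

Lemma cdiff_mult (f g : C -> C) (z : C) :
  cdiff f z -> cdiff g z -> cdiff (fun y => f y * g y) z.
Proof. intros [l Hl] [m Hm]. eexists. apply cder_mult; eassumption. Qed.

Lemma cder_opp (f : C -> C) (z l : C) : cder f z l -> cder (fun y => - f y) z (- l).
Proof.
  intros H. apply cder_ext_near with (fun y => - (1) * f y).
  - exists 1%R. split. lra. intros; ring.
  - eapply cder_eq. apply cder_mult. apply cder_const. exact H. cbv beta. ring.
Qed.

Lemma cder_minus (f g : C -> C) (z l m : C) :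
  cder f z l -> cder g z m -> cder (fun y => f y - g y) z (l - m).
Proof. intros Hf Hg. apply cder_plus. exact Hf. now apply cder_opp. Qed.

Lemma cdiff_minus (f g : C -> C) (z : C) :
  cdiff f z -> cdiff g z -> cdiff (fun y => f y - g y) z.
Proof. intros [l Hl] [m Hm]. eexists. apply cder_minus; eassumption. Qed.

Lemma cdiff_comp (f g : C -> C) (z : C) :
  cdiff f z -> cdiff g (f z) -> cdiff (fun y => g (f y)) z.
Proof. intros [l Hl] [m Hm]. eexists. apply (cder_comp f g); eassumption. Qed.

Lemma cdiff_inv (f : C -> C) (z : C) : cdiff f z -> f z <> 0 -> cdiff (fun y => / f y) z.
Proof. intros H Hz. apply (cdiff_comp f Cinv); auto. eexists. now apply cder_inv. Qed.

Lemma cdiff_div (f g : C -> C) (z : C) :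
  cdiff f z -> cdiff g z -> g z <> 0 -> cdiff (fun y => f y / g y) z.
Proof. intros Hf Hg Hz. apply cdiff_mult; auto. now apply cdiff_inv. Qed.

Lemma cdiff_pow (f : C -> C) (n : nat) (z : C) : cdiff f z -> cdiff (fun y => f y ^ n) z.
Proof.
  intros H. induction n; simpl. apply cdiff_const. now apply cdiff_mult.
Qed.

Lemma cder_shift (f : C -> C) (z0 z l : C) :
  cder f (z - z0) l -> cder (fun y => f (y - z0)) z l.
Proof.
  intros H. eapply cder_eq.
  - apply (cder_comp (fun y => y - z0) f).
    + apply cder_minus. apply cder_id. apply cder_const.
    + exact H.
  - ring.
Qed.

(** * Complex power series *)

Definition is_Cseries (u : nat -> C) (l : C) : Prop :=
  is_series (fun n => Re (u n)) (Re l) /\ is_series (fun n => Im (u n)) (Im l).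

Lemma is_Cseries_ext (u v : nat -> C) (l : C) : (forall n, u n = v n) -> is_Cseries u l ->
  is_Cseries v l.
Proof.
  intros E [H1 H2]. split.
  - apply is_series_ext with (2 := H1). intros; now rewrite E.
  - apply is_series_ext with (2 := H2). intros; now rewrite E.
Qed.

Lemma is_Cseries_plus (u v : nat -> C) (l m : C) :
  is_Cseries u l -> is_Cseries v m -> is_Cseries (fun n => u n + v n) (l + m).
Proof.
  intros [H1 H2] [H3 H4]. split.
  - apply (is_series_plus _ _ _ _ H1 H3).
  - apply (is_series_plus _ _ _ _ H2 H4).
Qed.

Lemma is_Cseries_scal (k : C) (u : nat -> C) (l : C) :
  is_Cseries u l -> is_Cseries (fun n => k * u n) (k * l).
Proof.
  intros [H1 H2]. split.
  - apply (is_series_minus _ _ _ _ (is_series_scal (Re k) _ _ H1) (is_series_scal (Im k) _ _ H2)).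
  - apply (is_series_plus _ _ _ _ (is_series_scal (Re k) _ _ H2) (is_series_scal (Im k) _ _ H1)).
Qed.

Lemma is_Cseries_incr_1 (u : nat -> C) (l : C) :
  is_Cseries (fun n => u (S n)) l -> is_Cseries u (u 0%nat + l).
Proof.
  intros [H1 H2]. split; apply is_series_decr_1.
  - match goal with |- is_series _ ?x => replace x with (Re l) end. exact H1.
    destruct (u 0%nat), l. unfold plus, opp, Cplus, Re, Im; simpl. ring.
  - match goal with |- is_series _ ?x => replace x with (Im l) end. exact H2.
    destruct (u 0%nat), l. unfold plus, opp, Cplus, Re, Im; simpl. ring.
Qed.

Lemma Cmod_le_abs (z : C) : (Cmod z <= Rabs (Re z) + Rabs (Im z))%R.
Proof.
  replace z with (RtoC (Re z) + Ci * RtoC (Im z)) at 1.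
  - eapply Rle_trans. apply Cmod_triangle. rewrite Cmod_mult, Cmod_Ci, !Cmod_R. lra.
  - destruct z; unfold Re, Im, Ci, RtoC, Cplus, Cmult; simpl. f_equal; ring.
Qed.

Lemma im_le_Cmod (c : C) : (Rabs (Im c) <= Cmod c)%R.
Proof. eapply Rle_trans. apply Rmax_r. apply (Rmax_Cmod c). Qed.

(** The factor [2] pays for bounding the real and the imaginary parts separately. *)
Lemma is_Cseries_le (u : nat -> C) (a : nat -> R) (l : C) :
  is_Cseries u l -> (forall n, (Cmod (u n) <= a n)%R) -> ex_series a ->
  (Cmod l <= 2 * Series a)%R.
Proof.
  intros [H1 H2] Ha Ea.
  assert (Hre : ex_series (fun n => Rabs (Re (u n)))).
  { apply (@ex_series_le R_AbsRing R_CompleteNormedModule) with a; [|easy].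
    intros n. unfold norm; simpl. unfold abs; simpl. rewrite Rabs_Rabsolu.
    eapply Rle_trans. apply re_le_Cmod. apply Ha. }
  assert (Him : ex_series (fun n => Rabs (Im (u n)))).
  { apply (@ex_series_le R_AbsRing R_CompleteNormedModule) with a; [|easy].
    intros n. unfold norm; simpl. unfold abs; simpl. rewrite Rabs_Rabsolu.
    eapply Rle_trans. apply im_le_Cmod. apply Ha. }
  eapply Rle_trans. apply Cmod_le_abs.
  rewrite <- (is_series_unique _ _ H1), <- (is_series_unique _ _ H2).
  assert (Rabs (Series (fun n => Re (u n))) <= Series a)%R.
  { eapply Rle_trans. apply Series_Rabs. exact Hre. apply Series_le; [|easy].
    intros n. split. apply Rabs_pos. eapply Rle_trans. apply re_le_Cmod. apply Ha. }
  assert (Rabs (Series (fun n => Im (u n))) <= Series a)%R.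
  { eapply Rle_trans. apply Series_Rabs. exact Him. apply Series_le; [|easy].
    intros n. split. apply Rabs_pos. eapply Rle_trans. apply im_le_Cmod. apply Ha. }
  lra.
Qed.

Lemma is_Cseries_abs (u : nat -> C) :
  ex_series (fun n => Cmod (u n)) ->
  is_Cseries u (Series (fun n => Re (u n)), Series (fun n => Im (u n))).
Proof.
  intros H. split; apply Series_correct.
  - apply (@ex_series_le R_AbsRing R_CompleteNormedModule) with (fun n => Cmod (u n)); [|easy].
    intros n. apply re_le_Cmod.
  - apply (@ex_series_le R_AbsRing R_CompleteNormedModule) with (fun n => Cmod (u n)); [|easy].
    intros n. apply im_le_Cmod.
Qed.

Fixpoint psum (u : nat -> C) (n : nat) : C :=
  match n with O => 0 | S n => psum u n + u n end.

Lemma psum_sum_n (u : nat -> C) (n : nat) :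
  @sum_n C_AbelianMonoid u n = psum u (S n).
Proof.
  induction n.
  - rewrite sum_O. simpl. ring.
  - rewrite sum_Sn, IHn. reflexivity.
Qed.

Lemma psum_Re (u : nat -> C) (n : nat) : Re (psum u (S n)) = sum_n (fun k => Re (u k)) n.
Proof.
  induction n.
  - rewrite sum_O. cbn [psum]. now rewrite Cplus_0_l.
  - rewrite sum_Sn, <- IHn. reflexivity.
Qed.

Lemma psum_Im (u : nat -> C) (n : nat) : Im (psum u (S n)) = sum_n (fun k => Im (u k)) n.
Proof.
  induction n.
  - rewrite sum_O. cbn [psum]. now rewrite Cplus_0_l.
  - rewrite sum_Sn, <- IHn. reflexivity.
Qed.

Lemma is_Cseries_lim (u : nat -> C) (l : C) (e : nat -> R) :
  (forall n, (Cmod (psum u n - l) <= e n)%R) -> is_lim_seq e 0 -> is_Cseries u l.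
Proof.
  intros H He. apply is_lim_seq_incr_1 in He.
  assert (K : forall (f : nat -> R) (x : R),
    (forall n, (Rabs (f n - x) <= e (S n))%R) -> is_lim_seq f x).
  { intros f x Hf. apply is_lim_seq_le_le with (fun n => x - e (S n))%R (fun n => x + e (S n))%R.
    - intros n. specialize (Hf n). apply Rabs_le_between in Hf. lra.
    - evar_last. apply is_lim_seq_minus'. apply is_lim_seq_const. exact He. f_equal; ring.
    - evar_last. apply is_lim_seq_plus'. apply is_lim_seq_const. exact He. f_equal; ring. }
  split; apply K; intros n.
  - rewrite <- psum_Re. eapply Rle_trans; [|apply (H (S n))].
    apply (re_le_Cmod (psum u (S n) - l)).
  - rewrite <- psum_Im. eapply Rle_trans; [|apply (H (S n))].
    apply (im_le_Cmod (psum u (S n) - l)).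
Qed.

(** A growth condition that stands for a lower bound on the radius of convergence: it
    holds for every [r >= 0] below the radius and fails for every [r] above it. *)
Definition power_bounded (c : nat -> C) (r : R) : Prop :=
  exists M : R, forall n : nat, (Cmod (c n) * r ^ n <= M)%R.

Lemma power_bounded_pos (c : nat -> C) (r : R) : power_bounded c r ->
  exists M : R, (0 < M)%R /\ forall n : nat, (Cmod (c n) * r ^ n <= M)%R.
Proof.
  intros [M H]. exists (Rabs M + 1)%R. split. pose proof (Rabs_pos M); lra.
  intros n. eapply Rle_trans. apply H. pose proof (Rle_abs M); lra.
Qed.

Lemma power_bounded_le (c : nat -> C) (r s : R) : (0 <= s <= r)%R -> power_bounded c r ->
  power_bounded c s.
Proof.
  intros Hs [M H]. exists M. intros n. eapply Rle_trans; [|apply H].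
  apply Rmult_le_compat_l. apply Cmod_ge_0. now apply pow_incr.
Qed.

Lemma power_bounded_plus (c d : nat -> C) (r : R) : (0 <= r)%R ->
  power_bounded c r -> power_bounded d r -> power_bounded (fun n => c n + d n) r.
Proof.
  intros Hr [M H] [N K]. exists (M + N)%R. intros n. specialize (H n). specialize (K n).
  pose proof (pow_le r n Hr). pose proof (Cmod_triangle (c n) (d n)). nra.
Qed.

Lemma power_bounded_scal (k : C) (c : nat -> C) (r : R) : power_bounded c r ->
  power_bounded (fun n => k * c n) r.
Proof.
  intros [M H]. exists (Cmod k * M)%R. intros n. rewrite Cmod_mult.
  rewrite Rmult_assoc. apply Rmult_le_compat_l. apply Cmod_ge_0. apply H.
Qed.

Lemma power_bounded_ext (c d : nat -> C) (r : R) : (forall n, c n = d n) -> power_bounded c r ->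
  power_bounded d r.
Proof. intros E [M H]. exists M. intros n. now rewrite <- E. Qed.

Lemma power_bounded_S (c : nat -> C) (r : R) : (0 < r)%R -> power_bounded c r ->
  power_bounded (fun n => c (S n)) r.
Proof.
  intros Hr [M H]. exists (M / r)%R. intros n. apply -> Rle_div_r; [|lra].
  replace (Cmod (c (S n)) * r ^ n * r)%R with (Cmod (c (S n)) * r ^ S n)%R by (simpl; ring).
  apply H.
Qed.

Lemma power_bounded_ex_series (c : nat -> C) (r s : R) : (0 <= s < r)%R -> power_bounded c r ->
  ex_series (fun n => Cmod (c n) * s ^ n)%R.
Proof.
  intros Hs [M H].
  apply (@ex_series_le R_AbsRing R_CompleteNormedModule) with (fun n => M * (s / r) ^ n)%R.
  - intros n. unfold norm; simpl. unfold abs; simpl. rewrite Rabs_pos_eq.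
    2: { apply Rmult_le_pos. apply Cmod_ge_0. apply pow_le; lra. }
    replace (Cmod (c n) * s ^ n)%R with (Cmod (c n) * r ^ n * (s / r) ^ n)%R.
    + apply Rmult_le_compat_r. apply pow_le. apply Rdiv_le_0_compat; lra. apply H.
    + rewrite Rmult_assoc, <- Rpow_mult_distr. do 2 f_equal. field. lra.
  - apply (ex_series_scal_l M (fun n => (s / r) ^ n)%R). apply ex_series_geom.
    rewrite Rabs_pos_eq. apply <- Rlt_div_l; lra. apply Rdiv_le_0_compat; lra.
Qed.

Lemma germ_sum_is_Cseries (c : nat -> C) (r : R) (z : C) : power_bounded c r -> (Cmod z < r)%R ->
  is_Cseries (fun n => c n * z ^ n) (germ_sum c z).
Proof.
  intros H Hz. apply is_Cseries_abs.
  apply ex_series_ext with (fun n => Cmod (c n) * Cmod z ^ n)%R.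
  - intros n. now rewrite Cmod_mult, Cmod_pow.
  - apply power_bounded_ex_series with r; auto. split; auto. apply Cmod_ge_0.
Qed.

Lemma germ_sum_eq (c : nat -> C) (z l : C) :
  is_Cseries (fun n => c n * z ^ n) l -> germ_sum c z = l.
Proof.
  intros [H1 H2]. apply is_series_unique in H1, H2. unfold germ_sum.
  rewrite H1, H2. now destruct l.
Qed.

Lemma germ_sum_ext (c d : nat -> C) (z : C) :
  (forall n, c n = d n) -> germ_sum c z = germ_sum d z.
Proof.
  intros E. unfold germ_sum. f_equal; apply Series_ext; intros; now rewrite E.
Qed.

Lemma germ_sum_plus (c d : nat -> C) (r : R) (z : C) :
  power_bounded c r -> power_bounded d r -> (Cmod z < r)%R ->
  germ_sum (fun n => c n + d n) z = germ_sum c z + germ_sum d z.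
Proof.
  intros Hc Hd Hz. apply germ_sum_eq.
  apply is_Cseries_ext with (fun n => c n * z ^ n + d n * z ^ n). intros; ring.
  apply is_Cseries_plus; now apply germ_sum_is_Cseries with r.
Qed.

Lemma germ_sum_scal (k : C) (c : nat -> C) (r : R) (z : C) :
  power_bounded c r -> (Cmod z < r)%R ->
  germ_sum (fun n => k * c n) z = k * germ_sum c z.
Proof.
  intros Hc Hz. apply germ_sum_eq.
  apply is_Cseries_ext with (fun n => k * (c n * z ^ n)). intros; ring.
  apply is_Cseries_scal; now apply germ_sum_is_Cseries with r.
Qed.

Lemma germ_sum_S (c : nat -> C) (r : R) (z : C) :
  power_bounded c r -> (Cmod z < r)%R ->
  germ_sum c z = c 0%nat + z * germ_sum (fun n => c (S n)) z.
Proof.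
  intros Hc Hz. assert (0 < r)%R by (pose proof (Cmod_ge_0 z); lra). apply germ_sum_eq.
  replace (c 0%nat) with (c 0%nat * z ^ 0) by (simpl; ring).
  apply (is_Cseries_incr_1 (fun n => c n * z ^ n)).
  apply is_Cseries_ext with (fun n => z * (c (S n) * z ^ n)). intros; simpl; ring.
  apply is_Cseries_scal; apply germ_sum_is_Cseries with r; auto. now apply power_bounded_S.
Qed.

Lemma germ_sum_0 (c : nat -> C) : germ_sum c 0 = c 0%nat.
Proof.
  apply germ_sum_eq.
  apply is_Cseries_lim with (fun n => match n with O => Cmod (c 0%nat) | S _ => 0%R end).
  - intros n. destruct n.
    + simpl. replace (0 - c 0%nat) with (- c 0%nat) by ring. rewrite Cmod_opp. lra.
    + replace (psum (fun n0 => c n0 * 0 ^ n0) (S n)) with (c 0%nat).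
      replace (c 0%nat - c 0%nat) with (RtoC 0) by ring. rewrite Cmod_0. lra.
      induction n. simpl; ring. simpl in *. rewrite <- IHn. ring.
  - apply is_lim_seq_incr_1. apply is_lim_seq_const.
Qed.

Lemma Cgeom_psum (z : C) (n : nat) : z <> 1 -> psum (fun k => z ^ k) n = (1 - z ^ n) / (1 - z).
Proof.
  intros Hz. assert (1 - z <> 0) by (apply Cminus_neq0; congruence).
  induction n; simpl. now field. rewrite IHn. now field.
Qed.

Lemma germ_sum_geom (w z : C) : (Cmod (w * z) < 1)%R ->
  germ_sum (fun n => w ^ n) z = 1 / (1 - w * z).
Proof.
  intros Hz. apply germ_sum_eq. set (x := w * z) in *.
  assert (Hx : x <> 1). { intros E. rewrite E, Cmod_1 in Hz. lra. }
  assert (Hx' : 1 - x <> 0) by (apply Cminus_neq0; congruence).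
  apply is_Cseries_ext with (fun n => x ^ n). { intros n. unfold x. now rewrite Cpow_mult_l. }
  apply is_Cseries_lim with (fun n => / Cmod (1 - x) * Cmod x ^ n)%R.
  - intros n. rewrite Cgeom_psum by easy.
    replace ((1 - x ^ n) / (1 - x) - 1 / (1 - x)) with (- (/ (1 - x) * x ^ n)) by now field.
    rewrite Cmod_opp, Cmod_mult, Cmod_inv, Cmod_pow by easy. lra.
  - evar_last. apply is_lim_seq_scal_l. apply is_lim_seq_geom.
    rewrite Rabs_pos_eq. exact Hz. apply Cmod_ge_0. simpl. f_equal; ring.
Qed.

(** * Differentiation of power series *)

(** Coefficients of [z f'(z)] and of [f'(z)]. *)
Definition theta_seq (c : nat -> C) (n : nat) : C := INR n * c n.
Definition deriv_seq (c : nat -> C) (n : nat) : C := INR (S n) * c (S n).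

Lemma Cmod_INR (n : nat) : Cmod (INR n) = INR n.
Proof. rewrite Cmod_R. apply Rabs_pos_eq. apply pos_INR. Qed.

(** The sum [1 + q + ... + q^n] is at least [(n + 1) q^n], and its product with [1 - q]
    telescopes. *)
Lemma linear_geom_bound (q : R) (n : nat) : (0 <= q < 1)%R ->
  ((INR n + 1) * q ^ n * (1 - q) <= 1 - q ^ S n)%R.
Proof.
  intros Hq. induction n. simpl; lra.
  rewrite S_INR.
  assert (0 <= q ^ S n)%R by (apply pow_le; lra).
  assert (q ^ S n <= 1)%R. { rewrite <- (pow1 (S n)). apply pow_incr. lra. }
  replace ((INR n + 1 + 1) * q ^ S n * (1 - q))%R with
    (q * ((INR n + 1) * q ^ n * (1 - q)) + q ^ S n * (1 - q))%R by (simpl; ring).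
  change (q ^ S (S n))%R with (q * q ^ S n)%R. nra.
Qed.

(** The factor [n] is absorbed by a geometric sequence of ratio [s / r < 1]. *)
Lemma power_bounded_theta_seq (c : nat -> C) (r s : R) : (0 <= s < r)%R -> power_bounded c r ->
  power_bounded (theta_seq c) s.
Proof.
  intros Hs Hc. destruct (power_bounded_pos _ _ Hc) as [M [HM H]].
  assert (Hq : (0 <= s / r < 1)%R).
  { split. apply Rdiv_le_0_compat; lra. apply <- Rlt_div_l; lra. }
  exists (M * / (1 - s / r))%R. intros n. unfold theta_seq. rewrite Cmod_mult, Cmod_INR.
  replace (INR n * Cmod (c n) * s ^ n)%R
    with ((Cmod (c n) * r ^ n) * (INR n * (s / r) ^ n))%R.
  - apply Rmult_le_compat.
    + apply Rmult_le_pos. apply Cmod_ge_0. apply pow_le; lra.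
    + apply Rmult_le_pos. apply pos_INR. apply pow_le; lra.
    + apply H.
    + rewrite <- (Rmult_1_l (/ _)). apply -> Rle_div_r; [|lra].
      pose proof (linear_geom_bound _ n Hq). pose proof (pow_le (s/r) n (proj1 Hq)).
      pose proof (pow_le (s/r) (S n) (proj1 Hq)). nra.
  - replace (s ^ n)%R with (r ^ n * (s / r) ^ n)%R. ring.
    rewrite <- Rpow_mult_distr. f_equal. field. lra.
Qed.

Lemma power_bounded_deriv_seq (c : nat -> C) (r s : R) : (0 < s < r)%R -> power_bounded c r ->
  power_bounded (deriv_seq c) s.
Proof.
  intros Hs Hc. apply (power_bounded_S (theta_seq c)). lra. apply power_bounded_theta_seq with r; auto. lra.
Qed.

Lemma germ_sum_theta (c : nat -> C) (r : R) (z : C) :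
  power_bounded c r -> (Cmod z < r)%R -> z * germ_sum (deriv_seq c) z = germ_sum (theta_seq c) z.
Proof.
  intros Hc Hz. pose proof (Cmod_ge_0 z).
  rewrite (germ_sum_S (theta_seq c) ((Cmod z + r) / 2)); [|apply power_bounded_theta_seq with r; auto; lra|lra].
  unfold theta_seq at 1. simpl INR. unfold deriv_seq, theta_seq. ring.
Qed.

(** If [e_n] is the left-hand difference, then
    [e_(n+1) = y e_n + n z^(n-1) (y - z)^2], and the bound follows by induction. *)
Lemma pow_taylor2 (y z : C) (rho : R) (n : nat) :
  (Cmod y <= rho)%R -> (Cmod z <= rho)%R ->
  (rho * rho * Cmod (y ^ n - z ^ n - (y - z) * (INR n * z ^ (n - 1)))
    <= INR n * INR n * rho ^ n * (Cmod (y - z) * Cmod (y - z)))%R.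
Proof.
  intros Hy Hz. pose proof (Cmod_ge_0 y). pose proof (Cmod_ge_0 z).
  induction n.
  - simpl. replace (1 - 1 - (y - z) * (0 * 1)) with (RtoC 0) by ring. rewrite Cmod_0. lra.
  - set (e := y ^ n - z ^ n - (y - z) * (INR n * z ^ (n - 1))) in *.
    replace (y ^ S n - z ^ S n - (y - z) * (INR (S n) * z ^ (S n - 1)))
      with (y * e + INR n * z ^ (n - 1) * ((y - z) * (y - z))).
    2: { unfold e. rewrite S_INR, RtoC_plus. destruct n; simpl. ring.
         rewrite !Nat.sub_0_r. ring. }
    set (h := Cmod (y - z)) in *.
    assert (H1 : (rho * rho * Cmod (INR n * z ^ (n - 1) * ((y - z) * (y - z)))
      <= INR n * rho ^ S n * (h * h))%R).
    { rewrite !Cmod_mult, Cmod_INR, Cmod_pow. fold h. destruct n.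
      - simpl. lra.
      - replace (S n - 1)%nat with n by lia. change (rho ^ S (S n))%R with (rho * (rho * rho ^ n))%R.
        assert (Cmod z ^ n <= rho ^ n)%R by (apply pow_incr; lra).
        replace (rho * rho * (INR (S n) * Cmod z ^ n * (h * h)))%R
          with ((rho * rho * INR (S n) * (h * h)) * Cmod z ^ n)%R by ring.
        replace (INR (S n) * (rho * (rho * rho ^ n)) * (h * h))%R
          with ((rho * rho * INR (S n) * (h * h)) * rho ^ n)%R by ring.
        apply Rmult_le_compat_l; auto.
        repeat apply Rmult_le_pos; try lra. apply pos_INR. apply Cmod_ge_0. apply Cmod_ge_0. }
    assert (H2 : (rho * rho * Cmod (y * e) <= rho * (INR n * INR n * rho ^ n * (h * h)))%R).
    { rewrite Cmod_mult. replace (rho * rho * (Cmod y * Cmod e))%R with (Cmod y * (rho * rho * Cmod e))%R by ring.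
      apply Rmult_le_compat; auto. repeat apply Rmult_le_pos; try lra. apply Cmod_ge_0. }
    apply Rle_trans with (rho * rho * (Cmod (y * e) + Cmod (INR n * z ^ (n - 1) * ((y - z) * (y - z)))))%R.
    { apply Rmult_le_compat_l. nra. apply Cmod_triangle. }
    rewrite Rmult_plus_distr_l. eapply Rle_trans. apply Rplus_le_compat; eassumption.
    rewrite S_INR. simpl pow.
    replace (rho * (INR n * INR n * rho ^ n * (h * h)) + INR n * (rho * rho ^ n) * (h * h))%R
      with ((INR n * INR n + INR n) * (rho * rho ^ n * (h * h)))%R by ring.
    replace ((INR n + 1) * (INR n + 1) * (rho * rho ^ n) * (h * h))%R
      with ((INR n + 1) * (INR n + 1) * (rho * rho ^ n * (h * h)))%R by ring.
    apply Rmult_le_compat_r. repeat apply Rmult_le_pos; try lra. apply pow_le; lra.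
    apply Cmod_ge_0. apply Cmod_ge_0. pose proof (pos_INR n). nra.
Qed.

(** By [pow_taylor2], the remainder of order one is at most [|y - z|^2] times the sum of
    [n^2 |c_n| rho^(n-2)], which converges for [rho] below the radius. *)
Lemma germ_sum_cder (c : nat -> C) (r : R) (z : C) :
  power_bounded c r -> (Cmod z < r)%R -> cder (germ_sum c) z (germ_sum (deriv_seq c) z).
Proof.
  intros Hc Hz. pose proof (Cmod_ge_0 z) as Hz0.
  (* [|z| < rho < s < t < r]: each multiplication of the coefficients by [n], and the
     final summation, costs a step inwards. *)
  set (rho := ((2 * Cmod z + r) / 3)%R). set (s := ((Cmod z + 2 * r) / 3)%R).
  set (t := ((s + r) / 2)%R).
  assert (Hr1 : (Cmod z < rho)%R) by (unfold rho; lra).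
  assert (Hr2 : (rho < s)%R) by (unfold rho, s; lra).
  assert (Hr3 : (s < t < r)%R) by (unfold t, s; lra).
  assert (Hr0 : (0 < rho)%R) by lra.
  assert (Hrr : (0 < rho * rho)%R) by now apply Rmult_lt_0_compat.
  assert (Ha : ex_series (fun n => Cmod (theta_seq (theta_seq c) n) * rho ^ n)%R).
  { apply power_bounded_ex_series with s. lra. apply power_bounded_theta_seq with t. lra. apply power_bounded_theta_seq with r; auto. lra. }
  set (B := Series (fun n => Cmod (theta_seq (theta_seq c) n) * rho ^ n)%R).
  assert (HB : (0 <= B)%R).
  { unfold B. rewrite (Series_ext _ (fun n => Rabs (Cmod (theta_seq (theta_seq c) n) * rho ^ n))).
    - eapply Rle_trans; [apply Rabs_pos|apply Series_Rabs].
      apply ex_series_ext with (2 := Ha). intros n. symmetry. apply Rabs_pos_eq.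
      apply Rmult_le_pos. apply Cmod_ge_0. apply pow_le; lra.
    - intros n. symmetry. apply Rabs_pos_eq.
      apply Rmult_le_pos. apply Cmod_ge_0. apply pow_le; lra. }
  assert (key : forall y, (Cmod y < rho)%R ->
    (Cmod (germ_sum c y - germ_sum c z - (y - z) * germ_sum (deriv_seq c) z)
      <= 2 * (Cmod (y - z) * Cmod (y - z) / (rho * rho) * B))%R).
  { intros y Hy.
    unfold B. rewrite <- Series_scal_l.
    apply is_Cseries_le with (fun n => c n * (y ^ n - z ^ n - (y - z) * (INR n * z ^ (n - 1)))).
    - apply is_Cseries_ext with (fun n => (c n * y ^ n + - (1) * (c n * z ^ n))
        + - (y - z) * (INR n * c n * z ^ (n - 1))).
      { intros; ring. }
      replace (germ_sum c y - germ_sum c z - (y - z) * germ_sum (deriv_seq c) z)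
        with ((germ_sum c y + - (1) * germ_sum c z) + - (y - z) * germ_sum (deriv_seq c) z) by ring.
      apply is_Cseries_plus; [apply is_Cseries_plus; [|apply is_Cseries_scal]|apply is_Cseries_scal].
      + apply germ_sum_is_Cseries with r; auto. lra.
      + apply germ_sum_is_Cseries with r; auto.
      + replace (germ_sum (deriv_seq c) z) with (INR 0 * c 0%nat * z ^ (0 - 1) + germ_sum (deriv_seq c) z)
          by (simpl; ring).
        apply (is_Cseries_incr_1 (fun n => INR n * c n * z ^ (n - 1))).
        apply is_Cseries_ext with (fun n => deriv_seq c n * z ^ n).
        { intros n. unfold deriv_seq. now replace (S n - 1)%nat with n by lia. }
        apply germ_sum_is_Cseries with s. apply power_bounded_deriv_seq with r; auto. lra. lra.
    - intros n. rewrite Cmod_mult. unfold theta_seq. rewrite !Cmod_mult, !Cmod_INR.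
      pose proof (pow_taylor2 y z rho n ltac:(lra) ltac:(lra)) as H.
      set (E := Cmod (y ^ n - z ^ n - (y - z) * (INR n * z ^ (n - 1)))) in *.
      set (h := Cmod (y - z)) in *.
      apply Rle_trans with (Cmod (c n) * (/ (rho * rho) * (INR n * INR n * rho ^ n * (h * h))))%R.
      2: { right. field. lra. }
      apply Rmult_le_compat_l. apply Cmod_ge_0.
      apply Rmult_le_reg_l with (rho * rho)%R. nra.
      eapply Rle_trans. exact H. right. field. lra.
    - now apply (ex_series_scal_l _ (fun n => Cmod (theta_seq (theta_seq c) n) * rho ^ n)%R). }
  intros eps He.
  assert (HD : (0 < eps * (rho * rho) / (2 * B + 1))%R).
  { apply Rdiv_lt_0_compat. now apply Rmult_lt_0_compat. lra. }
  destruct (near_ball 0 z rho ltac:(now replace (z - 0) with z by ring)) as [d [Hd H]].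
  exists (Rmin d (eps * (rho * rho) / (2 * B + 1))). split. now apply Rmin_glb_lt.
  intros y Hy.
  pose proof (H y (Rlt_le_trans _ _ _ Hy (Rmin_l _ _))) as H1.
  pose proof (Rlt_le _ _ (Rlt_le_trans _ _ _ Hy (Rmin_r _ _))) as H2.
  replace (y - 0) with y in H1 by ring.
  eapply Rle_trans. apply key; auto.
  set (h := Cmod (y - z)) in *. assert (0 <= h)%R by apply Cmod_ge_0.
  apply Rle_div_r in H2; [|lra].
  replace (2 * (h * h / (rho * rho) * B))%R with (h * (2 * B * h) / (rho * rho))%R by (field; lra).
  apply <- Rle_div_l; nra.
Qed.

Lemma germ_sum_cdiff (c : nat -> C) (r : R) (z : C) :
  power_bounded c r -> (Cmod z < r)%R -> cdiff (germ_sum c) z.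
Proof. intros H Hz. eexists. now apply germ_sum_cder with r. Qed.

(** Continuity at the origin gives [c 0 = 0]; then dividing by the variable shifts the
    coefficients. Since this division makes sense only away from the origin, the
    induction assumes vanishing on a punctured neighbourhood. *)
Lemma germ_sum_identity0 (n : nat) : forall (c : nat -> C) (r : R),
  (0 < r)%R -> power_bounded c r ->
  near 0 (fun z => z <> 0 -> germ_sum c z = 0) -> c n = 0.
Proof.
  assert (base : forall (c : nat -> C) (r : R), (0 < r)%R -> power_bounded c r ->
    near 0 (fun z => z <> 0 -> germ_sum c z = 0) -> c 0%nat = 0).
  { intros c r Hr Hc H.
    destruct (Ceq_dec (c 0%nat) 0) as [|n0]; auto. exfalso.
    assert (Hm : (0 < Cmod (c 0%nat))%R) by now apply Cmod_gt_0.
    assert (Cc : ccont (germ_sum c) 0).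
    { apply cdiff_ccont. apply germ_sum_cdiff with r; auto. now rewrite Cmod_0. }
    destruct (near_and _ _ _ H (Cc _ Hm)) as [d [Hd K]].
    assert (Hd2 : Cmod (RtoC (d / 2)) = (d / 2)%R) by (rewrite Cmod_R; apply Rabs_pos_eq; lra).
    destruct (K (RtoC (d / 2))) as [K1 K2].
    { replace (RtoC (d / 2) - 0) with (RtoC (d / 2)) by ring. lra. }
    rewrite K1, germ_sum_0 in K2.
    - replace (0 - c 0%nat) with (- c 0%nat) in K2 by ring. rewrite Cmod_opp in K2. lra.
    - apply Cmod_gt_0. lra. }
  induction n; intros c r Hr Hc H.
  - now apply base with r.
  - apply (IHn (fun n => c (S n)) r); auto. now apply power_bounded_S.
    destruct (near_and _ _ _ H (near_ball 0 0 r ltac:(replace (0 - 0) with (RtoC 0) by ring; now rewrite Cmod_0)))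
      as [d [Hd K]].
    exists d. split; auto. intros z Hz Hz0. destruct (K z Hz) as [K1 K2].
    replace (z - 0) with z in K2 by ring.
    specialize (K1 Hz0). rewrite (germ_sum_S c r) in K1; auto.
    rewrite (base c r Hr Hc H) in K1.
    replace (germ_sum (fun n0 => c (S n0)) z) with ((0 + z * germ_sum (fun n0 => c (S n0)) z) / z)
      by now field.
    rewrite K1. now field.
Qed.

Lemma germ_sum_identity (c d : nat -> C) (r : R) :
  (0 < r)%R -> power_bounded c r -> power_bounded d r ->
  near 0 (fun z => germ_sum c z = germ_sum d z) -> forall n, c n = d n.
Proof.
  intros Hr Hc Hd H n. apply Cminus_eq0.
  assert (Hd' : power_bounded (fun n => - (1) * d n) r) by now apply power_bounded_scal.
  replace (c n - d n) with (c n + - (1) * d n) by ring.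
  apply (germ_sum_identity0 n (fun n => c n + - (1) * d n) r); auto. apply power_bounded_plus; auto. lra.
  destruct (near_and _ _ _ H (near_ball 0 0 r ltac:(replace (0 - 0) with (RtoC 0) by ring; now rewrite Cmod_0)))
      as [e [He K]].
  exists e. split; auto. intros z Hz _. destruct (K z Hz) as [K1 K2].
  replace (z - 0) with z in K2 by ring.
  rewrite (germ_sum_plus c _ r), (germ_sum_scal _ d r), K1; auto. ring.
Qed.

(** * Radius of convergence *)

Lemma power_bounded_convergence_disc (c : nat -> C) (r : R) (z : C) :
  power_bounded c r -> (0 <= r)%R -> (Cmod z < r)%R -> convergence_disc c z.
Proof.
  intros [M H] Hr Hz. unfold convergence_disc, germ_radius.
  destruct (CV_radius_bounded (fun n => Cmod (c n))) as [U _].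
  apply Rbar_lt_le_trans with (Finite r). exact Hz. apply U. exists M. intros n.
  rewrite Rabs_pos_eq. apply H. apply Rmult_le_pos. apply Cmod_ge_0. now apply pow_le.
Qed.

Lemma germ_radius_power_bounded (c : nat -> C) (x : R) :
  (0 <= x)%R -> Rbar_lt (Finite x) (germ_radius c) ->
  exists r : R, (x < r)%R /\ power_bounded c r.
Proof.
  intros Hx H. destruct (CV_radius_bounded (fun n => Cmod (c n))) as [_ L].
  apply NNPP. intros N.
  apply (Rbar_lt_not_le _ _ H). apply L. intros r [M Hr].
  destruct (Rle_dec r x) as [|n]; auto. exfalso. apply N. exists r. split. lra.
  exists M. intros k. eapply Rle_trans. apply Rle_abs. apply Hr.
Qed.

Lemma convergence_disc_power_bounded (c : nat -> C) (z : C) : convergence_disc c z ->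
  exists r : R, (Cmod z < r)%R /\ power_bounded c r.
Proof. apply germ_radius_power_bounded. apply Cmod_ge_0. Qed.

Lemma convergent_germ_power_bounded (c : nat -> C) : convergent_germ c ->
  exists r : R, (0 < r)%R /\ power_bounded c r.
Proof. apply germ_radius_power_bounded. lra. Qed.

(** * Goursat's theorem for rectangles *)

Definition rcont (f : R -> C) (t : R) : Prop :=
  continuous (fun s => Re (f s)) t /\ continuous (fun s => Im (f s)) t.

Definition cint (f : R -> C) (a b : R) : C :=
  (RInt (fun t => Re (f t)) a b, RInt (fun t => Im (f t)) a b).

Definition seg_cont (f : R -> C) (a b : R) : Prop :=
  forall t, (a <= t <= b)%R -> rcont f t.

Lemma seg_cont_ex (f : R -> C) (a b : R) : (a <= b)%R -> seg_cont f a b ->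
  ex_RInt (fun t => Re (f t)) a b /\ ex_RInt (fun t => Im (f t)) a b.
Proof.
  intros Hab H. split; apply (@ex_RInt_continuous R_CompleteNormedModule);
  intros t Ht; rewrite Rmin_left, Rmax_right in Ht by auto; now apply H.
Qed.

Lemma cint_lin (f g : R -> C) (k : C) (a b : R) : (a <= b)%R ->
  seg_cont f a b -> seg_cont g a b ->
  cint (fun t => f t + k * g t) a b = cint f a b + k * cint g a b.
Proof.
  intros Hab Hf Hg.
  destruct (seg_cont_ex _ _ _ Hab Hf) as [F1 F2].
  destruct (seg_cont_ex _ _ _ Hab Hg) as [G1 G2].
  apply (RInt_correct (V := R_CompleteNormedModule)) in F1, F2, G1, G2.
  unfold cint, Cplus, Cmult. cbn [fst snd]. f_equal;
  apply (is_RInt_unique (V := R_CompleteNormedModule)).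
  - exact (is_RInt_plus _ _ _ _ _ _ F1 (is_RInt_minus _ _ _ _ _ _
      (is_RInt_scal _ _ _ (fst k) _ G1) (is_RInt_scal _ _ _ (snd k) _ G2))).
  - exact (is_RInt_plus _ _ _ _ _ _ F2 (is_RInt_plus _ _ _ _ _ _
      (is_RInt_scal _ _ _ (fst k) _ G2) (is_RInt_scal _ _ _ (snd k) _ G1))).
Qed.

Lemma cint_ext (f g : R -> C) (a b : R) : (a <= b)%R ->
  (forall t, (a <= t <= b)%R -> f t = g t) -> cint f a b = cint g a b.
Proof.
  intros Hab H. unfold cint. f_equal; apply (RInt_ext (V := R_CompleteNormedModule)); intros t Ht;
  rewrite Rmin_left, Rmax_right in Ht by auto; rewrite H; auto; lra.
Qed.

Lemma cint_const (k : C) (a b : R) : cint (fun _ => k) a b = RtoC (b - a) * k.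
Proof.
  unfold cint. rewrite !(RInt_const (V := R_CompleteNormedModule)).
  destruct k. unfold scal, RtoC, Cmult, Re, Im; simpl. unfold mult; simpl. f_equal; ring.
Qed.

Lemma cint_Chasles (f : R -> C) (a m b : R) : (a <= m <= b)%R -> seg_cont f a b ->
  cint f a b = cint f a m + cint f m b.
Proof.
  intros Hm Hf.
  destruct (seg_cont_ex f a m) as [A1 A2]; [lra|intros t Ht; apply Hf; lra|].
  destruct (seg_cont_ex f m b) as [B1 B2]; [lra|intros t Ht; apply Hf; lra|].
  unfold cint, Cplus. cbn [fst snd]. f_equal.
  - now rewrite <- (RInt_Chasles (V := R_CompleteNormedModule) _ a m b A1 B1).
  - now rewrite <- (RInt_Chasles (V := R_CompleteNormedModule) _ a m b A2 B2).
Qed.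

(** The factor [2] is not optimal: it comes from bounding the real and the imaginary
    parts separately. *)
Lemma cint_bound (f : R -> C) (M a b : R) : (a <= b)%R -> seg_cont f a b ->
  (forall t, (a <= t <= b)%R -> (Cmod (f t) <= M)%R) ->
  (Cmod (cint f a b) <= 2 * M * (b - a))%R.
Proof.
  intros Hab Hf HM. destruct (seg_cont_ex _ _ _ Hab Hf) as [F1 F2].
  eapply Rle_trans. apply Cmod_le_abs. unfold cint. cbn [Re Im fst snd].
  assert (Rabs (RInt (fun t => Re (f t)) a b) <= (b - a) * M)%R.
  { apply abs_RInt_le_const; auto. intros t Ht. eapply Rle_trans. apply re_le_Cmod. auto. }
  assert (Rabs (RInt (fun t => Im (f t)) a b) <= (b - a) * M)%R.
  { apply abs_RInt_le_const; auto. intros t Ht. eapply Rle_trans. apply im_le_Cmod. auto. }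
  lra.
Qed.

Lemma rcont_intro (f : R -> C) (t : R) :
  (forall eps, (0 < eps)%R -> exists d, (0 < d)%R /\
     forall s, (Rabs (s - t) < d)%R -> (Cmod (f s - f t) < eps)%R) -> rcont f t.
Proof.
  intros H. split; apply filterlim_locally; intros eps;
  destruct (H eps (cond_pos eps)) as [d [Hd K]]; exists (mkposreal d Hd); intros s Hs;
  specialize (K s Hs).
  - eapply Rle_lt_trans; [|exact K]. apply (re_le_Cmod (f s - f t)).
  - eapply Rle_lt_trans; [|exact K]. apply (im_le_Cmod (f s - f t)).
Qed.

Lemma ccont_horizontal (f : C -> C) (x y : R) : ccont f (x, y) -> rcont (fun t => f (t, y)) x.
Proof.
  intros H. apply rcont_intro. intros eps He. destruct (H eps He) as [d [Hd K]].
  exists d. split; auto. intros s Hs. apply K.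
  replace ((s, y) - (x, y)) with (RtoC (s - x)). now rewrite Cmod_R.
  unfold RtoC, Cminus, Cplus, Copp; simpl. f_equal; ring.
Qed.

Lemma ccont_vertical (f : C -> C) (x y : R) : ccont f (x, y) -> rcont (fun t => f (x, t)) y.
Proof.
  intros H. apply rcont_intro. intros eps He. destruct (H eps He) as [d [Hd K]].
  exists d. split; auto. intros s Hs. apply K.
  replace ((x, s) - (x, y)) with (Ci * RtoC (s - y)). now rewrite Cmod_mult, Cmod_Ci, Cmod_R, Rmult_1_l.
  unfold RtoC, Cminus, Cplus, Copp, Cmult, Ci; simpl. f_equal; ring.
Qed.

(** The boundary is run through counterclockwise. *)
Definition rect_int (f : C -> C) (a b c d : R) : C :=
  cint (fun t => f (t, c)) a b + Ci * cint (fun t => f (b, t)) c d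
  - cint (fun t => f (t, d)) a b - Ci * cint (fun t => f (a, t)) c d.

Definition rect_bdry (a b c d : R) (z : C) : Prop :=
  (a <= Re z <= b)%R /\ (c <= Im z <= d)%R /\
  (Re z = a \/ Re z = b \/ Im z = c \/ Im z = d).

Definition rect_bdry_cont (f : C -> C) (a b c d : R) : Prop :=
  forall z, rect_bdry a b c d z -> ccont f z.

Lemma rect_bdry_cont_sides (f : C -> C) (a b c d : R) : (a <= b)%R -> (c <= d)%R ->
  rect_bdry_cont f a b c d ->
  seg_cont (fun t => f (t, c)) a b /\ seg_cont (fun t => f (b, t)) c d /\
  seg_cont (fun t => f (t, d)) a b /\ seg_cont (fun t => f (a, t)) c d.
Proof.
  intros Hab Hcd H. repeat split;
  first [apply (ccont_horizontal f)|apply (ccont_vertical f)]; apply H; unfold rect_bdry; simpl; lra.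
Qed.

Lemma rect_int_lin (f g : C -> C) (k : C) (a b c d : R) : (a <= b)%R -> (c <= d)%R ->
  rect_bdry_cont f a b c d -> rect_bdry_cont g a b c d ->
  rect_int (fun z => f z + k * g z) a b c d = rect_int f a b c d + k * rect_int g a b c d.
Proof.
  intros Hab Hcd Hf Hg.
  destruct (rect_bdry_cont_sides _ _ _ _ _ Hab Hcd Hf) as (F1 & F2 & F3 & F4).
  destruct (rect_bdry_cont_sides _ _ _ _ _ Hab Hcd Hg) as (G1 & G2 & G3 & G4).
  unfold rect_int.
  rewrite (cint_lin (fun t => f (t, c)) (fun t => g (t, c))) by auto.
  rewrite (cint_lin (fun t => f (t, d)) (fun t => g (t, d))) by auto.
  rewrite (cint_lin (fun t => f (a, t)) (fun t => g (a, t))) by auto.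
  rewrite (cint_lin (fun t => f (b, t)) (fun t => g (b, t))) by auto.
  ring.
Qed.

Lemma rect_int_ext (f g : C -> C) (a b c d : R) : (a <= b)%R -> (c <= d)%R ->
  (forall z, rect_bdry a b c d z -> f z = g z) -> rect_int f a b c d = rect_int g a b c d.
Proof.
  intros Hab Hcd H. unfold rect_int.
  rewrite (cint_ext (fun t => f (t, c)) (fun t => g (t, c)));
    [|auto|intros t Ht; apply H; unfold rect_bdry; simpl; lra].
  rewrite (cint_ext (fun t => f (t, d)) (fun t => g (t, d)));
    [|auto|intros t Ht; apply H; unfold rect_bdry; simpl; lra].
  rewrite (cint_ext (fun t => f (a, t)) (fun t => g (a, t)));
    [|auto|intros t Ht; apply H; unfold rect_bdry; simpl; lra].
  rewrite (cint_ext (fun t => f (b, t)) (fun t => g (b, t)));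
    [|auto|intros t Ht; apply H; unfold rect_bdry; simpl; lra].
  reflexivity.
Qed.

Lemma rect_int_bound (f : C -> C) (M a b c d : R) : (a <= b)%R -> (c <= d)%R ->
  rect_bdry_cont f a b c d -> (forall z, rect_bdry a b c d z -> (Cmod (f z) <= M)%R) ->
  (Cmod (rect_int f a b c d) <= 4 * M * ((b - a) + (d - c)))%R.
Proof.
  intros Hab Hcd Hf HM.
  destruct (rect_bdry_cont_sides _ _ _ _ _ Hab Hcd Hf) as (F1 & F2 & F3 & F4).
  assert (B1 := cint_bound _ M _ _ Hab F1 ltac:(intros t Ht; apply HM; unfold rect_bdry; simpl; lra)).
  assert (B2 := cint_bound _ M _ _ Hcd F2 ltac:(intros t Ht; apply HM; unfold rect_bdry; simpl; lra)).
  assert (B3 := cint_bound _ M _ _ Hab F3 ltac:(intros t Ht; apply HM; unfold rect_bdry; simpl; lra)).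
  assert (B4 := cint_bound _ M _ _ Hcd F4 ltac:(intros t Ht; apply HM; unfold rect_bdry; simpl; lra)).
  unfold rect_int.
  eapply Rle_trans. apply Cmod_triangle_minus.
  eapply Rle_trans. apply Rplus_le_compat_r. apply Cmod_triangle_minus.
  eapply Rle_trans. apply Rplus_le_compat_r. apply Rplus_le_compat_r. apply Cmod_triangle.
  rewrite !Cmod_mult, !Cmod_Ci. lra.
Qed.

Lemma rect_int_cut_v (f : C -> C) (a m b c d : R) : (a <= m <= b)%R ->
  (forall x, (a <= x <= b)%R -> ccont f (x, c) /\ ccont f (x, d)) ->
  rect_int f a b c d = rect_int f a m c d + rect_int f m b c d.
Proof.
  intros Hm H. unfold rect_int.
  rewrite (cint_Chasles (fun t => f (t, c)) a m b Hm)
    by (intros t Ht; apply (ccont_horizontal f); now apply H).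
  rewrite (cint_Chasles (fun t => f (t, d)) a m b Hm)
    by (intros t Ht; apply (ccont_horizontal f); now apply H).
  ring.
Qed.

Lemma rect_int_cut_h (f : C -> C) (a b c m d : R) : (c <= m <= d)%R ->
  (forall y, (c <= y <= d)%R -> ccont f (a, y) /\ ccont f (b, y)) ->
  rect_int f a b c d = rect_int f a b c m + rect_int f a b m d.
Proof.
  intros Hm H. unfold rect_int.
  rewrite (cint_Chasles (fun t => f (a, t)) c m d Hm)
    by (intros t Ht; apply (ccont_vertical f); now apply H).
  rewrite (cint_Chasles (fun t => f (b, t)) c m d Hm)
    by (intros t Ht; apply (ccont_vertical f); now apply H).
  ring.
Qed.

(** On opposite sides an affine function differs by a constant, and the two pairs of
    sides cancel: no primitive is needed. *)
Lemma rect_int_affine (k l : C) (a b c d : R) : (a <= b)%R -> (c <= d)%R ->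
  rect_int (fun z => k + l * z) a b c d = 0.
Proof.
  intros Hab Hcd. unfold rect_int.
  assert (K : forall (f g : R -> C) (u v : R) (e : C), (u <= v)%R ->
    seg_cont g u v -> (forall t, f t = e + g t) -> cint f u v = RtoC (v - u) * e + cint g u v).
  { intros f g u v e Huv Hg Hfg.
    rewrite (cint_ext f (fun t => e + 1 * g t)) by (auto; intros; rewrite Hfg; ring).
    rewrite cint_lin; auto. rewrite cint_const. ring.
    intros t _. apply rcont_intro. intros eps He. exists 1%R. split. lra. intros s _.
    replace (e - e) with (RtoC 0) by ring. now rewrite Cmod_0. }
  assert (Kc : forall z, ccont (fun z => k + l * z) z).
  { intros z. apply ccont_plus. apply ccont_const. apply ccont_mult. apply ccont_const. apply ccont_id. }
  rewrite (K (fun t => k + l * (t, c)) (fun t => k + l * (t, d)) a b (l * ((0%R, c) - (0%R, d)))).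
  rewrite (K (fun t => k + l * (b, t)) (fun t => k + l * (a, t)) c d (l * ((b, 0%R) - (a, 0%R)))).
  - replace ((b, 0%R) - (a, 0%R)) with (RtoC (b - a)).
    replace ((0%R, c) - (0%R, d)) with (- Ci * RtoC (d - c)).
    ring.
    unfold RtoC, Cminus, Cplus, Copp, Cmult, Ci; simpl. f_equal; ring.
    unfold RtoC, Cminus, Cplus, Copp, Cmult, Ci; simpl. f_equal; ring.
  - auto.
  - intros t _. apply (ccont_vertical (fun z => k + l * z)). apply Kc.
  - intros t. replace (b, t) with ((b, 0%R) - (a, 0%R) + (a, t)). ring.
    unfold RtoC, Cminus, Cplus, Copp, Cmult, Ci; simpl. f_equal; ring.
  - auto.
  - intros t _. apply (ccont_horizontal (fun z => k + l * z)). apply Kc.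
  - intros t. replace (t, c) with ((0%R, c) - (0%R, d) + (t, d)). ring.
    unfold RtoC, Cminus, Cplus, Copp, Cmult, Ci; simpl. f_equal; ring.
Qed.

Lemma nested_intervals (a b : nat -> R) :
  (forall n, (a n <= a (S n))%R) -> (forall n, (b (S n) <= b n)%R) ->
  (forall n, (a n <= b n)%R) -> exists x, forall n, (a n <= x <= b n)%R.
Proof.
  intros Ha Hb Hab.
  assert (Ma : forall n m, (n <= m)%nat -> (a n <= a m)%R).
  { intros n m H. induction H. lra. eapply Rle_trans. eassumption. apply Ha. }
  assert (Mb : forall n m, (n <= m)%nat -> (b m <= b n)%R).
  { intros n m H. induction H. lra. eapply Rle_trans. apply Hb. eassumption. }
  assert (K : forall n m, (a n <= b m)%R).
  { intros n m. apply Rle_trans with (a (max n m)). apply Ma; lia.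
    apply Rle_trans with (b (max n m)). auto. apply Mb; lia. }
  destruct (completeness (fun x => exists n, x = a n)) as [x [U L]].
  - exists (b 0%nat). intros y [n ->]. apply K.
  - exists (a 0%nat). now exists 0%nat.
  - exists x. intros n. split.
    + apply U. now exists n.
    + apply L. intros y [m ->]. apply K.
Qed.

(** Otherwise bad quarters could be chosen again and again, and these shrink to a point
    around which the small rectangles are good. *)
Lemma rect_bisection (P : R -> R -> R -> R -> Prop) (a b c d : R) :
  (a <= b)%R -> (c <= d)%R ->
  (forall a b c d, (a <= b)%R -> (c <= d)%R ->
     P a ((a+b)/2)%R c ((c+d)/2)%R -> P ((a+b)/2)%R b c ((c+d)/2)%R ->
     P a ((a+b)/2)%R ((c+d)/2)%R d -> P ((a+b)/2)%R b ((c+d)/2)%R d -> P a b c d) ->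
  (forall x y, (a <= x <= b)%R -> (c <= y <= d)%R -> exists e, (0 < e)%R /\
     forall a' b' c' d', (a <= a')%R -> (b' <= b)%R -> (c <= c')%R -> (d' <= d)%R ->
       (a' <= x <= b')%R -> (c' <= y <= d')%R -> (b' - a' < e)%R -> (d' - c' < e)%R ->
       P a' b' c' d') ->
  P a b c d.
Proof.
  intros Hab Hcd Hq Hl. apply NNPP. intros Hn.
  set (Inv := fun q : (R * R) * (R * R) =>
    (fst (fst q) <= snd (fst q))%R /\ (fst (snd q) <= snd (snd q))%R /\
    ~ P (fst (fst q)) (snd (fst q)) (fst (snd q)) (snd (snd q))).
  assert (Hstep : forall q, exists q', Inv q -> Inv q' /\
    (fst (fst q) <= fst (fst q'))%R /\ (snd (fst q') <= snd (fst q))%R /\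
    (fst (snd q) <= fst (snd q'))%R /\ (snd (snd q') <= snd (snd q))%R /\
    (snd (fst q') - fst (fst q') = (snd (fst q) - fst (fst q)) / 2)%R /\
    (snd (snd q') - fst (snd q') = (snd (snd q) - fst (snd q)) / 2)%R).
  { intros [[u v] [s t]].
    destruct (classic (Inv ((u, v), (s, t)))) as [I|]; [|exists ((u, v), (s, t)); tauto].
    destruct I as (I1 & I2 & I3). cbn [fst snd] in *.
    destruct (classic (P u ((u+v)/2) s ((s+t)/2)))%R as [P1|P1].
    2: { exists ((u, (u+v)/2), (s, (s+t)/2))%R. unfold Inv; cbn [fst snd]. intros _.
         repeat split; auto; lra. }
    destruct (classic (P ((u+v)/2) v s ((s+t)/2)))%R as [P2|P2].
    2: { exists (((u+v)/2, v), (s, (s+t)/2))%R. unfold Inv; cbn [fst snd]. intros _.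
         repeat split; auto; lra. }
    destruct (classic (P u ((u+v)/2) ((s+t)/2) t))%R as [P3|P3].
    2: { exists ((u, (u+v)/2), ((s+t)/2, t))%R. unfold Inv; cbn [fst snd]. intros _.
         repeat split; auto; lra. }
    exists (((u+v)/2, v), ((s+t)/2, t))%R. unfold Inv; cbn [fst snd]. intros _.
    repeat split; auto; try lra. }
  set (step := fun q => proj1_sig (constructive_indefinite_description _ (Hstep q))).
  set (Q := fun n => Nat.iter n step ((a, b), (c, d))).
  assert (HI : forall n, Inv (Q n)).
  { induction n. unfold Inv; simpl; auto.
    simpl. unfold step. destruct (constructive_indefinite_description _ (Hstep _)) as [q' Hq'].
    simpl. now apply Hq'. }
  assert (HS : forall n,
    (fst (fst (Q n)) <= fst (fst (Q (S n))))%R /\ (snd (fst (Q (S n))) <= snd (fst (Q n)))%R /\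
    (fst (snd (Q n)) <= fst (snd (Q (S n))))%R /\ (snd (snd (Q (S n))) <= snd (snd (Q n)))%R /\
    (snd (fst (Q (S n))) - fst (fst (Q (S n))) = (snd (fst (Q n)) - fst (fst (Q n))) / 2)%R /\
    (snd (snd (Q (S n))) - fst (snd (Q (S n))) = (snd (snd (Q n)) - fst (snd (Q n))) / 2)%R).
  { intros n. specialize (HI n). simpl. unfold step.
    destruct (constructive_indefinite_description _ (Hstep _)) as [q' Hq'].
    simpl. now apply Hq'. }
  destruct (nested_intervals (fun n => fst (fst (Q n))) (fun n => snd (fst (Q n)))) as [x Hx];
    [intros; apply HS|intros; apply HS|intros; apply HI|].
  destruct (nested_intervals (fun n => fst (snd (Q n))) (fun n => snd (snd (Q n)))) as [y Hy];
    [intros; apply HS|intros; apply HS|intros; apply HI|].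
  destruct (Hl x y (Hx 0%nat) (Hy 0%nat)) as [e [He K]].
  assert (Hsz : forall n, (snd (fst (Q n)) - fst (fst (Q n)) = (b - a) * (/2) ^ n)%R /\
    (snd (snd (Q n)) - fst (snd (Q n)) = (d - c) * (/2) ^ n)%R).
  { induction n. simpl; split; ring.
    destruct (HS n) as (_ & _ & _ & _ & E1 & E2). rewrite E1, E2.
    destruct IHn as [-> ->]. simpl pow. split; field. }
  assert (Hsub : forall n, (a <= fst (fst (Q n)))%R /\ (snd (fst (Q n)) <= b)%R /\
    (c <= fst (snd (Q n)))%R /\ (snd (snd (Q n)) <= d)%R).
  { induction n. simpl; repeat split; lra.
    destruct (HS n) as (H1 & H2 & H3 & H4 & _). lra. }
  assert (Hs : (0 < b - a + (d - c) + 1)%R) by lra.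
  destruct (pow_lt_1_zero (/2) ltac:(rewrite Rabs_pos_eq; lra) (e / (b - a + (d - c) + 1))%R
    ltac:(now apply Rdiv_lt_0_compat)) as [N HN].
  specialize (HN N (le_n _)). rewrite Rabs_pos_eq in HN by (apply pow_le; lra).
  assert (0 < (/2) ^ N)%R by (apply pow_lt; lra).
  assert (HN' : ((b - a + (d - c) + 1) * (/2) ^ N < e)%R).
  { apply Rlt_le_trans with ((b - a + (d - c) + 1) * (e / (b - a + (d - c) + 1)))%R.
    apply Rmult_lt_compat_l; auto. right. field. lra. }
  destruct (HI N) as (_ & _ & HP). apply HP. destruct (Hsub N) as (S1 & S2 & S3 & S4).
  destruct (Hsz N) as [Z1 Z2].
  apply K; auto; try apply Hx; try apply Hy; nra.
Qed.

Lemma Cmod_le_sides (a b c d : R) (z p : C) :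
  (a <= Re z <= b)%R -> (c <= Im z <= d)%R -> (a <= Re p <= b)%R -> (c <= Im p <= d)%R ->
  (Cmod (z - p) <= (b - a) + (d - c))%R.
Proof.
  intros. eapply Rle_trans. apply Cmod_le_abs.
  destruct z as [z1 z2], p as [p1 p2]. unfold Re, Im, Cminus, Cplus, Copp in *; simpl in *.
  apply Rplus_le_compat; apply Rabs_le; lra.
Qed.

(** The estimate [|integral| <= eps * size^2] passes from the quarters of a rectangle to
    the whole, and it holds for small rectangles around a point: up to an affine function,
    whose integral vanishes, [f] is there at most [eps] times the distance. *)
Lemma goursat (f : C -> C) (a b c d : R) : (a <= b)%R -> (c <= d)%R ->
  (forall x y, (a <= x <= b)%R -> (c <= y <= d)%R -> cdiff f (x, y)) ->
  rect_int f a b c d = 0.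
Proof.
  intros Hab Hcd Hf. apply Cmod_eq_0.
  assert (Hc : forall x y, (a <= x <= b)%R -> (c <= y <= d)%R -> ccont f (x, y)).
  { intros. apply cdiff_ccont. now apply Hf. }
  assert (key : forall eps, (0 < eps)%R ->
    (Cmod (rect_int f a b c d) <= eps * ((b - a) + (d - c)) ^ 2)%R).
  { intros eps He.
    assert (G : (a <= a)%R -> (b <= b)%R -> (c <= c)%R -> (d <= d)%R ->
      (Cmod (rect_int f a b c d) <= eps * ((b - a) + (d - c)) ^ 2)%R).
    2: { apply G; lra. }
    apply (rect_bisection (fun a' b' c' d' => (a <= a')%R -> (b' <= b)%R -> (c <= c')%R -> (d' <= d)%R ->
      (Cmod (rect_int f a' b' c' d') <= eps * ((b' - a') + (d' - c')) ^ 2)%R)); auto.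
    - intros a' b' c' d' Hab' Hcd' Q1 Q2 Q3 Q4 S1 S2 S3 S4.
      specialize (Q1 ltac:(lra) ltac:(lra) ltac:(lra) ltac:(lra)).
      specialize (Q2 ltac:(lra) ltac:(lra) ltac:(lra) ltac:(lra)).
      specialize (Q3 ltac:(lra) ltac:(lra) ltac:(lra) ltac:(lra)).
      specialize (Q4 ltac:(lra) ltac:(lra) ltac:(lra) ltac:(lra)).
      rewrite (rect_int_cut_v f a' ((a'+b')/2) b') by (try lra; intros; split; apply Hc; lra).
      rewrite (rect_int_cut_h f a' ((a'+b')/2) c' ((c'+d')/2) d') by (try lra; intros; split; apply Hc; lra).
      rewrite (rect_int_cut_h f ((a'+b')/2) b' c' ((c'+d')/2) d') by (try lra; intros; split; apply Hc; lra).
      eapply Rle_trans. apply Cmod_triangle.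
      eapply Rle_trans. apply Rplus_le_compat; apply Cmod_triangle.
      eapply Rle_trans. apply Rplus_le_compat; apply Rplus_le_compat; eassumption.
      right. field.
    - intros x y Hx Hy. destruct (Hf x y Hx Hy) as [l Hl].
      destruct (Hl (eps / 4)%R ltac:(lra)) as [e [He' K]].
      exists (e / 2)%R. split. lra.
      intros a' b' c' d' S1 S2 S3 S4 Hx' Hy' Hs1 Hs2 _ _ _ _.
      assert (Hdist : forall z, rect_bdry a' b' c' d' z -> (Cmod (z - (x, y)) <= (b' - a') + (d' - c'))%R).
      { intros z (B1 & B2 & _). apply Cmod_le_sides; simpl; auto. }
      rewrite (rect_int_ext f (fun z => (f (x, y) + - (l * (x, y)) + l * z) + 1 * (f z - f (x, y) - (z - (x, y)) * l)))
        by (try lra; intros; ring).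
      assert (Kc : forall z, ccont (fun z => f (x, y) + - (l * (x, y)) + l * z) z).
      { intros z. apply ccont_plus. apply ccont_const. apply ccont_mult. apply ccont_const. apply ccont_id. }
      assert (Hb : rect_bdry_cont (fun z => f z - f (x, y) - (z - (x, y)) * l) a' b' c' d').
      { intros [u v] (B1 & B2 & _). simpl in *. apply cdiff_ccont.
        apply cdiff_minus. apply cdiff_minus. apply Hf; lra. apply cdiff_const.
        apply cdiff_mult. apply cdiff_minus. apply cdiff_id. apply cdiff_const. apply cdiff_const. }
      rewrite rect_int_lin; try lra; auto.
      2: { intros z _. apply Kc. }
      rewrite rect_int_affine by lra.
      replace (0 + 1 * rect_int (fun z => f z - f (x, y) - (z - (x, y)) * l) a' b' c' d') with
        (rect_int (fun z => f z - f (x, y) - (z - (x, y)) * l) a' b' c' d') by ring.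
      eapply Rle_trans.
      apply rect_int_bound with (M := (eps / 4 * ((b' - a') + (d' - c')))%R); try lra; auto.
      + intros z Hz. eapply Rle_trans. apply K.
        * eapply Rle_lt_trans. now apply Hdist. lra.
        * apply Rmult_le_compat_l. lra. now apply Hdist.
      + right. field. }
  set (s := ((b - a) + (d - c))%R) in *.
  assert (Hs : (0 <= s ^ 2)%R) by apply pow2_ge_0.
  pose proof (Cmod_ge_0 (rect_int f a b c d)) as H0.
  destruct (Rle_lt_or_eq_dec _ _ H0) as [H1|]; [|auto]. exfalso.
  specialize (key (Cmod (rect_int f a b c d) / (2 * (s ^ 2 + 1)))%R
    ltac:(apply Rdiv_lt_0_compat; lra)).
  set (m := Cmod (rect_int f a b c d)) in *.
  assert (m / (2 * (s ^ 2 + 1)) * s ^ 2 <= m / 2)%R; [|lra].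
  apply Rle_trans with (m / (2 * (s ^ 2 + 1)) * (s ^ 2 + 1))%R.
  - apply Rmult_le_compat_l. apply Rdiv_le_0_compat; lra. lra.
  - right. field. lra.
Qed.

(** Cutting along the lines through the sides of the hole leaves, besides the hole,
    rectangles to which Goursat's theorem applies. *)
Lemma rect_int_hole (f : C -> C) (a b c d a1 b1 c1 d1 : R) :
  (a <= a1 <= b1)%R -> (b1 <= b)%R -> (c <= c1 <= d1)%R -> (d1 <= d)%R ->
  (forall x y, (a <= x <= b)%R -> (c <= y <= d)%R ->
     ~ (a1 < x < b1 /\ c1 < y < d1)%R -> cdiff f (x, y)) ->
  rect_int f a b c d = rect_int f a1 b1 c1 d1.
Proof.
  intros Ha Hb Hc Hd Hf.
  rewrite (rect_int_cut_v f a a1 b) by (try lra; intros; split; apply cdiff_ccont; apply Hf; lra).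
  rewrite (rect_int_cut_v f a1 b1 b) by (try lra; intros; split; apply cdiff_ccont; apply Hf; lra).
  rewrite (rect_int_cut_h f a1 b1 c c1 d) by (try lra; intros; split; apply cdiff_ccont; apply Hf; lra).
  rewrite (rect_int_cut_h f a1 b1 c1 d1 d) by (try lra; intros; split; apply cdiff_ccont; apply Hf; lra).
  rewrite (goursat f a a1 c d) by (try lra; intros; apply Hf; lra).
  rewrite (goursat f b1 b c d) by (try lra; intros; apply Hf; lra).
  rewrite (goursat f a1 b1 c c1) by (try lra; intros; apply Hf; lra).
  rewrite (goursat f a1 b1 d1 d) by (try lra; intros; apply Hf; lra).
  ring.
Qed.

(** * Holomorphic functions are sums of power series *)

Definition square_int (f : C -> C) (L : R) : C := rect_int f (-L) L (-L) L.
Definition square_bdry (L : R) : C -> Prop := rect_bdry (-L) L (-L) L.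

Lemma square_bdry_Cmod (L : R) (z : C) : (0 < L)%R -> square_bdry L z -> (L <= Cmod z)%R.
Proof.
  intros HL (H1 & H2 & H3). pose proof (re_le_Cmod z). pose proof (im_le_Cmod z).
  destruct H3 as [E|[E|[E|E]]]; rewrite E in *.
  - rewrite Rabs_left in H; lra.
  - rewrite Rabs_pos_eq in H; lra.
  - rewrite Rabs_left in H0; lra.
  - rewrite Rabs_pos_eq in H0; lra.
Qed.

Lemma square_bdry_neq (L : R) (z p : C) : (Cmod p < L)%R -> square_bdry L z -> z <> p.
Proof.
  intros Hp Hz ->. pose proof (Cmod_ge_0 p).
  pose proof (square_bdry_Cmod L p ltac:(lra) Hz). lra.
Qed.

Lemma square_bdry_dist (L : R) (z p : C) : (Cmod p < L)%R -> square_bdry L z ->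
  (L - Cmod p <= Cmod (z - p))%R.
Proof.
  intros Hp Hz. pose proof (Cmod_ge_0 p).
  pose proof (square_bdry_Cmod L z ltac:(lra) Hz). pose proof (Cmod_rev z p). lra.
Qed.

Definition winding (L : R) : C := square_int Cinv L.

(** The value is [2 i pi]. That it is not zero is seen on imaginary parts: on each of the
    four sides the integrand is the positive function [L / (t^2 + L^2)]. *)
Lemma winding_neq0 (L : R) : (0 < L)%R -> winding L <> 0.
Proof.
  intros HL H. apply (f_equal Im) in H.
  set (k := fun t => (L / (t ^ 2 + L ^ 2))%R).
  assert (Hk : forall t, (0 < t ^ 2 + L ^ 2)%R).
  { intros t. pose proof (pow2_ge_0 t). pose proof (pow_lt L 2 HL). lra. }
  assert (E : Im (winding L) = (RInt k (-L) L + RInt k (-L) L + RInt k (-L) L + RInt k (-L) L)%R).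
  { unfold winding, square_int, rect_int, cint, Ci, Cminus, Cplus, Copp, Cmult, Im. cbn [fst snd].
    rewrite (RInt_ext (V := R_CompleteNormedModule) (fun t => snd (/ (t, (- L)%R))) k).
    2: { intros t _. unfold Cinv, k; simpl. field. specialize (Hk t). simpl in Hk. lra. }
    rewrite (RInt_ext (V := R_CompleteNormedModule) (fun t => Re (/ (L, t))) k).
    2: { intros t _. unfold Cinv, Re, k; simpl. field. specialize (Hk t). simpl in Hk. lra. }
    rewrite (RInt_ext (V := R_CompleteNormedModule) (fun t => snd (/ (t, L))) (fun t => opp (k t))).
    2: { intros t _. unfold Cinv, k, opp; simpl. field. specialize (Hk t). simpl in Hk. lra. }
    rewrite (RInt_ext (V := R_CompleteNormedModule) (fun t => Re (/ ((- L)%R, t))) (fun t => opp (k t))).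
    2: { intros t _. unfold Cinv, Re, k, opp; simpl. field. specialize (Hk t). simpl in Hk. lra. }
    rewrite (RInt_opp (V := R_CompleteNormedModule)).
    2: { apply (@ex_RInt_continuous R_CompleteNormedModule). intros t _.
         apply (@ex_derive_continuous R_AbsRing R_NormedModule).
         unfold k. auto_derive. specialize (Hk t). simpl in Hk. lra. }
    unfold opp; simpl. ring. }
  assert (0 < RInt k (-L) L)%R.
  { apply RInt_gt_0. lra.
    - intros t _. apply Rdiv_lt_0_compat; auto.
    - intros t _. apply (@ex_derive_continuous R_AbsRing R_NormedModule).
      unfold k. auto_derive. specialize (Hk t). simpl in Hk. lra. }
  rewrite E in H. simpl in H. lra.
Qed.

(** The difference of the two kernels decays like the inverse square of the variable,
    and its integral over the square does not change when the square grows. *)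
Lemma square_int_kernel (L : R) (p : C) : (Cmod p < L)%R ->
  square_int (fun z => / (z - p)) L = winding L.
Proof.
  intros Hp. pose proof (Cmod_ge_0 p) as Hp0. apply Cminus_eq0.
  assert (Dp : forall z, z <> p -> cdiff (fun z => / (z - p)) z).
  { intros z Hz. apply (cdiff_inv (fun z => z - p)). apply cdiff_minus. apply cdiff_id.
    apply cdiff_const. now apply Cminus_neq0. }
  assert (Di : forall z : C, z <> 0 -> cdiff Cinv z).
  { intros z Hz. exists (- / (z * z)). apply cder_inv. exact Hz. }
  assert (K : forall M, (L <= M)%R ->
    square_int (fun z => / (z - p) + - (1) * / z) L = square_int (fun z => / (z - p) + - (1) * / z) M).
  { intros M HM. unfold square_int. symmetry. apply rect_int_hole; try lra. intros x y Hx Hy Hxy.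
    assert (Hn : forall q, (Cmod q < L)%R -> (x, y) <> q).
    { intros q Hq E. apply Hxy.
      pose proof (re_le_Cmod q) as R1. pose proof (im_le_Cmod q) as R2.
      subst q. simpl in R1, R2. split; apply Rabs_lt_between; lra. }
    apply cdiff_plus. apply Dp. now apply Hn. apply cdiff_mult. apply cdiff_const. apply Di.
    apply Hn. rewrite Cmod_0. lra. }
  replace (square_int (fun z => / (z - p)) L - winding L)
    with (square_int (fun z => / (z - p) + - (1) * / z) L).
  2: { unfold square_int, winding. rewrite rect_int_lin; try lra. unfold square_int. ring.
       intros z Hz. apply cdiff_ccont. apply Dp. now apply square_bdry_neq with L.
       intros z Hz. apply cdiff_ccont. apply Di. apply square_bdry_neq with L; auto. rewrite Cmod_0. lra. }
  apply Cmod_eq_0. apply Rle_antisym; [|apply Cmod_ge_0].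
  apply le_epsilon. intros eps He. rewrite Rplus_0_l.
  (* makes the bound [16 |p| / (M - |p|)] below at most [eps] *)
  set (M := (L + 16 * Cmod p / eps)%R).
  assert (HM : (L <= M)%R).
  { unfold M. assert (0 <= 16 * Cmod p / eps)%R by (apply Rdiv_le_0_compat; lra). lra. }
  rewrite (K M HM).
  assert (HMp : (0 < M - Cmod p)%R) by lra.
  unfold square_int. eapply Rle_trans. apply rect_int_bound with (M := (Cmod p / (M * (M - Cmod p)))%R); try lra.
  - intros z Hz. apply cdiff_ccont. apply cdiff_plus. apply Dp. apply square_bdry_neq with M; auto. lra.
    apply cdiff_mult. apply cdiff_const. apply Di.
    apply square_bdry_neq with M; auto. rewrite Cmod_0. lra.
  - intros z Hz.
    assert (z <> 0) by (apply square_bdry_neq with M; auto; rewrite Cmod_0; lra).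
    assert (z <> p) by (apply square_bdry_neq with M; auto; lra).
    assert (z - p <> 0) by now apply Cminus_neq0.
    replace (/ (z - p) + - (1) * / z) with (p / (z * (z - p))) by now field.
    rewrite Cmod_div, Cmod_mult by now apply Cmult_neq_0.
    apply Rmult_le_compat_l; auto. apply Rinv_le_contravar. apply Rmult_lt_0_compat; lra.
    apply Rmult_le_compat; try lra.
    apply square_bdry_Cmod; auto; lra. apply square_bdry_dist; auto; lra.
  - replace (4 * (Cmod p / (M * (M - Cmod p))) * (M - - M + (M - - M)))%R
      with (16 * Cmod p / (M - Cmod p))%R by (field; lra).
    apply <- Rle_div_l; [|lra].
    apply Rle_trans with (eps * (16 * Cmod p / eps))%R.
    right. field. lra. apply Rmult_le_compat_l. lra. unfold M. lra.
Qed.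

Definition cdiff_square (f : C -> C) (L : R) : Prop :=
  forall x y, (-L <= x <= L)%R -> (-L <= y <= L)%R -> cdiff f (x, y).

Lemma cdiff_square_bdry (f : C -> C) (L : R) : cdiff_square f L ->
  rect_bdry_cont f (-L) L (-L) L.
Proof.
  intros H [x y] (H1 & H2 & _). apply cdiff_ccont. now apply H.
Qed.

(** The difference quotient is differentiable off [p] and bounded near [p], so the
    integral reduces to arbitrarily small squares around [p]. *)
Lemma cauchy_square (f : C -> C) (L : R) (p : C) : (Cmod p < L)%R -> cdiff_square f L ->
  square_int (fun z => f z * / (z - p)) L = f p * winding L.
Proof.
  intros Hp Hf. pose proof (Cmod_ge_0 p) as Hp0.
  rewrite <- (square_int_kernel L p Hp).
  assert (Dp : forall z, z <> p -> cdiff (fun z => / (z - p)) z).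
  { intros z Hz. apply (cdiff_inv (fun z => z - p)). apply cdiff_minus. apply cdiff_id.
    apply cdiff_const. now apply Cminus_neq0. }
  set (g := fun z => (f z - f p) * / (z - p)).
  assert (Hb : rect_bdry_cont (fun z => / (z - p)) (-L) L (-L) L).
  { intros z Hz. apply cdiff_ccont. apply Dp. now apply square_bdry_neq with L. }
  assert (E : square_int g L = square_int (fun z => f z * / (z - p)) L
     - f p * square_int (fun z => / (z - p)) L).
  { unfold square_int. rewrite (rect_int_ext g (fun z => f z * / (z - p) + (- f p) * / (z - p)));
      [|lra|lra|intros; unfold g; ring].
    rewrite rect_int_lin; try lra. ring.
    intros z Hz. apply ccont_mult. now apply (cdiff_square_bdry f L Hf). now apply Hb.
    exact Hb. }
  apply Cminus_eq0. rewrite <- E.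
  assert (Hin : (-L < Re p < L)%R /\ (-L < Im p < L)%R).
  { pose proof (re_le_Cmod p). pose proof (im_le_Cmod p).
    split; apply Rabs_lt_between; lra. }
  assert (Hfp : cdiff f p) by (rewrite (surjective_pairing p); apply Hf; unfold Re, Im in *; lra).
  destruct Hfp as [l Hl].
  destruct (Hl 1%R ltac:(lra)) as [e [He K]].
  apply Cmod_eq_0. apply Rle_antisym; [|apply Cmod_ge_0].
  apply le_epsilon. intros eps Heps. rewrite Rplus_0_l.
  pose proof (Cmod_ge_0 l) as Hl0.
  (* near [p] the quotient is at most [1 + |l|], so the integral over the square of
     half-side [s] is at most [16 (1 + |l|) s] *)
  set (s := Rmin (Rmin (e / 3) ((L - Cmod p) / 2)) (eps / (16 * (1 + Cmod l)))%R).
  assert (Hs : (0 < s)%R).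
  { repeat apply Rmin_glb_lt; try lra. apply Rdiv_lt_0_compat; lra. }
  assert (Hs1 : (s <= e / 3)%R) by (eapply Rle_trans; [apply Rmin_l|apply Rmin_l]).
  assert (Hs2 : (s <= (L - Cmod p) / 2)%R) by (eapply Rle_trans; [apply Rmin_l|apply Rmin_r]).
  assert (Hs3 : (s <= eps / (16 * (1 + Cmod l)))%R) by apply Rmin_r.
  assert (Hsq : (-L <= Re p - s)%R /\ (Re p + s <= L)%R /\ (-L <= Im p - s)%R /\ (Im p + s <= L)%R).
  { pose proof (re_le_Cmod p) as R1. pose proof (im_le_Cmod p) as R2.
    apply Rabs_le_between in R1, R2. lra. }
  assert (Hg : forall z, z <> p -> cdiff f z -> cdiff g z).
  { intros z Hz Hfz. apply cdiff_mult; auto. apply cdiff_minus. auto. apply cdiff_const. }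
  unfold square_int. rewrite (rect_int_hole g _ _ _ _ (Re p - s) (Re p + s) (Im p - s) (Im p + s)); try lra.
  2: { intros x y Hx Hy Hxy. apply Hg. intros <-. apply Hxy. simpl. lra. now apply Hf. }
  eapply Rle_trans. apply rect_int_bound with (M := (1 + Cmod l)%R); try lra.
  - intros z Hz. assert (Hzp : z <> p).
    { intros ->. destruct Hz as (H1 & H2 & H3). lra. }
    apply cdiff_ccont. apply Hg; auto. destruct Hz as (H1 & H2 & _).
    rewrite (surjective_pairing z). apply Hf; unfold Re, Im in *; lra.
  - intros z Hz. assert (Hzp : z <> p).
    { intros ->. destruct Hz as (H1 & H2 & H3). lra. }
    assert (Hzp' : z - p <> 0) by now apply Cminus_neq0.
    assert (Hlt : (Cmod (z - p) < e)%R).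
    { eapply Rle_lt_trans. apply Cmod_le_abs. destruct Hz as (H1 & H2 & _).
      destruct z as [z1 z2], p as [p1 p2]. simpl in *.
      assert (Rabs (z1 + - p1) <= s)%R by (apply Rabs_le; lra).
      assert (Rabs (z2 + - p2) <= s)%R by (apply Rabs_le; lra). lra. }
    specialize (K z Hlt).
    unfold g. replace ((f z - f p) * / (z - p)) with ((f z - f p - (z - p) * l) / (z - p) + l) by now field.
    eapply Rle_trans. apply Cmod_triangle. apply Rplus_le_compat_r.
    rewrite Cmod_div by auto. apply <- Rle_div_l. exact K. now apply Cmod_gt_0.
  - apply Rle_trans with (16 * (1 + Cmod l) * s)%R. right; ring.
    apply Rle_trans with (16 * (1 + Cmod l) * (eps / (16 * (1 + Cmod l))))%R.
    apply Rmult_le_compat_l; lra. right. field. lra.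
Qed.

Lemma seg_bounded (f : R -> C) (a b : R) : seg_cont f a b ->
  exists M, forall t, (a <= t <= b)%R -> (Cmod (f t) <= M)%R.
Proof.
  intros H.
  destruct (bounded_continuity (fun t => Re (f t)) a b) as [M1 H1].
  { intros t Ht. now apply H. }
  destruct (bounded_continuity (fun t => Im (f t)) a b) as [M2 H2].
  { intros t Ht. now apply H. }
  exists (M1 + M2)%R. intros t Ht. eapply Rle_trans. apply Cmod_le_abs.
  apply Rplus_le_compat; apply Rlt_le; [now apply H1|now apply H2].
Qed.

Lemma square_bounded (f : C -> C) (L : R) : (0 < L)%R -> rect_bdry_cont f (-L) L (-L) L ->
  exists M, (0 < M)%R /\ forall z, square_bdry L z -> (Cmod (f z) <= M)%R.
Proof.
  intros HL H.
  destruct (rect_bdry_cont_sides f (-L) L (-L) L ltac:(lra) ltac:(lra) H) as (F1 & F2 & F3 & F4).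
  destruct (seg_bounded _ _ _ F1) as [M1 H1].
  destruct (seg_bounded _ _ _ F2) as [M2 H2].
  destruct (seg_bounded _ _ _ F3) as [M3 H3].
  destruct (seg_bounded _ _ _ F4) as [M4 H4].
  exists (Rmax (Rmax M1 M2) (Rmax M3 M4) + 1)%R.
  pose proof (Rmax_l M1 M2). pose proof (Rmax_r M1 M2).
  pose proof (Rmax_l M3 M4). pose proof (Rmax_r M3 M4).
  pose proof (Rmax_l (Rmax M1 M2) (Rmax M3 M4)). pose proof (Rmax_r (Rmax M1 M2) (Rmax M3 M4)).
  split.
  - pose proof (H1 0%R ltac:(lra)). pose proof (Cmod_ge_0 (f (0%R, (-L)%R))). lra.
  - intros [x y] (Hx & Hy & Hz). simpl in *. destruct Hz as [E|[E|[E|E]]]; subst.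
    + specialize (H4 y Hy). lra.
    + specialize (H2 y Hy). lra.
    + specialize (H1 x Hx). lra.
    + specialize (H3 x Hx). lra.
Qed.

(** In Cauchy's formula, the kernel [/ (z - p)] is expanded in powers of [p / z], whose
    modulus on the square is at most [|p| / L]; [Rm n] is the integral of the remainder. *)
Lemma power_series_square (f : C -> C) (L : R) : (0 < L)%R -> cdiff_square f L ->
  exists c, power_bounded c L /\ forall p, (Cmod p < L)%R -> f p = germ_sum c p.
Proof.
  intros HL Hf.
  assert (HW : winding L <> 0) by now apply winding_neq0.
  assert (HWm : (0 < Cmod (winding L))%R) by now apply Cmod_gt_0.
  pose proof (cdiff_square_bdry f L Hf) as Hfb.
  destruct (square_bounded f L HL Hfb) as [M [HM HfM]].
  assert (Hz0 : forall z : C, square_bdry L z -> z <> 0).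
  { intros z Hz. apply square_bdry_neq with L; auto. rewrite Cmod_0. lra. }
  assert (Cpw : forall n z, square_bdry L z -> ccont (fun z => / z ^ n) z).
  { intros n z Hz. apply cdiff_ccont. apply (cdiff_inv (fun z => z ^ n)).
    apply cdiff_pow. apply cdiff_id. apply Cpow_nz. now apply Hz0. }
  set (I := fun n => square_int (fun z => f z * / z ^ S n) L).
  exists (fun n => I n / winding L). split.
  - exists (16 * M / Cmod (winding L))%R. intros n. rewrite Cmod_div by auto.
    assert (Cmod (I n) <= 4 * (M * / L ^ S n) * ((L - - L) + (L - - L)))%R.
    { unfold I, square_int. apply rect_int_bound; try lra.
      - intros z Hz. apply ccont_mult; auto.
      - intros z Hz. rewrite Cmod_mult, Cmod_inv, Cmod_pow by now apply Cpow_nz, Hz0.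
        apply Rmult_le_compat; auto. apply Cmod_ge_0.
        + apply Rlt_le, Rinv_0_lt_compat, pow_lt. apply Cmod_gt_0. now apply Hz0.
        + apply Rinv_le_contravar. now apply pow_lt. apply pow_incr. split. lra.
          now apply square_bdry_Cmod. }
    replace (16 * M / Cmod (winding L))%R
      with (4 * (M * / L ^ S n) * (L - - L + (L - - L)) / Cmod (winding L) * L ^ n)%R.
    2: { simpl. field. repeat split; try lra. apply pow_nonzero; lra. }
    apply Rmult_le_compat_r. apply pow_le; lra.
    apply Rmult_le_compat_r. apply Rlt_le, Rinv_0_lt_compat; auto. auto.
  - intros p Hp. symmetry. apply germ_sum_eq. pose proof (Cmod_ge_0 p) as Hp0.
    assert (Hzp : forall z, square_bdry L z -> z - p <> 0).
    { intros z Hz. apply Cminus_neq0. now apply square_bdry_neq with L. }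
    assert (Ck : forall z, square_bdry L z -> ccont (fun z => / (z - p)) z).
    { intros z Hz. apply cdiff_ccont. apply (cdiff_inv (fun z => z - p)).
      apply cdiff_minus. apply cdiff_id. apply cdiff_const. auto. }
    set (Rm := fun n => square_int (fun z => f z * / z ^ n * / (z - p)) L).
    assert (Hrem : forall n, f p * winding L = psum (fun k => I k * p ^ k) n + p ^ n * Rm n).
    { induction n.
      - rewrite <- (cauchy_square f L p Hp Hf). simpl. unfold Rm.
        unfold square_int. rewrite (rect_int_ext (fun z => f z * / z ^ 0 * / (z - p)) (fun z => f z * / (z - p))).
        ring. lra. lra. intros z Hz. simpl. field. now apply Hzp.
      - assert (E : Rm n = I n + p * Rm (S n)).
        { unfold Rm, I, square_int.
          rewrite (rect_int_ext _ (fun z => f z * / z ^ S n + p * (f z * / z ^ S n * / (z - p)))).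
          2: lra. 2: lra.
          2: { intros z Hz. simpl. field. repeat split. now apply Hzp. now apply Cpow_nz, Hz0. now apply Hz0. }
          apply rect_int_lin; try lra.
          + intros z Hz. apply ccont_mult; auto.
          + intros z Hz. apply ccont_mult; auto. apply ccont_mult; auto. }
        rewrite IHn, E. cbn [psum]. rewrite Cpow_S. ring. }
    apply is_Cseries_lim with (fun n => 16 * L * M / (L - Cmod p) / Cmod (winding L) * (Cmod p / L) ^ n)%R.
    + intros n.
      assert (E : psum (fun k => I k / winding L * p ^ k) n = psum (fun k => I k * p ^ k) n / winding L).
      { clear Hrem. induction n; simpl. now field. rewrite IHn. now field. }
      rewrite E. replace (f p) with (f p * winding L / winding L) by now field.
      rewrite (Hrem n).
      replace (psum (fun k => I k * p ^ k) n / winding L -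
        (psum (fun k => I k * p ^ k) n + p ^ n * Rm n) / winding L) with (- (p ^ n * Rm n / winding L)) by now field.
      rewrite Cmod_opp, Cmod_div, Cmod_mult, Cmod_pow by auto.
      assert (HR : (Cmod (Rm n) <= 4 * (M * / L ^ n * / (L - Cmod p)) * ((L - - L) + (L - - L)))%R).
      { unfold Rm, square_int. apply rect_int_bound; try lra.
        - intros z Hz. apply ccont_mult; auto. apply ccont_mult; auto.
        - intros z Hz. rewrite !Cmod_mult, !Cmod_inv, Cmod_pow by (try apply Cpow_nz; auto).
          pose proof (square_bdry_dist L z p Hp Hz). pose proof (square_bdry_Cmod L z HL Hz).
          assert (0 < / Cmod z ^ n)%R by (apply Rinv_0_lt_compat, pow_lt; lra).
          assert (0 < / Cmod (z - p))%R by (apply Rinv_0_lt_compat; lra).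
          apply Rmult_le_compat; try lra.
          + apply Rmult_le_pos; try lra. apply Cmod_ge_0.
          + apply Rmult_le_compat; auto; try lra. apply Cmod_ge_0.
            apply Rinv_le_contravar. now apply pow_lt. apply pow_incr. lra.
          + apply Rinv_le_contravar; lra. }
      apply Rle_trans with (Cmod p ^ n * (4 * (M * / L ^ n * / (L - Cmod p)) * (L - - L + (L - - L))) / Cmod (winding L))%R.
      * apply Rmult_le_compat_r. apply Rlt_le, Rinv_0_lt_compat; auto.
        apply Rmult_le_compat_l. now apply pow_le. auto.
      * right. unfold Rdiv at 4. rewrite Rpow_mult_distr, pow_inv. field.
        repeat split; try lra. apply pow_nonzero; lra.
    + evar_last. apply is_lim_seq_scal_l. apply is_lim_seq_geom.
      rewrite Rabs_pos_eq. apply <- Rlt_div_l; lra. apply Rdiv_le_0_compat; lra.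
      simpl. f_equal; ring.
Qed.

Lemma power_series_disc (f : C -> C) (z0 : C) (r : R) : (0 < r)%R ->
  (forall z, (Cmod (z - z0) < 2 * r)%R -> cdiff f z) ->
  exists c, power_bounded c r /\ forall z, (Cmod (z - z0) < r)%R -> f z = germ_sum c (z - z0).
Proof.
  intros Hr Hf.
  destruct (power_series_square (fun x => f (x + z0)) r Hr) as [c [Hc H]].
  - intros x y Hx Hy. apply (cdiff_comp (fun x => x + z0) f).
    apply cdiff_plus. apply cdiff_id. apply cdiff_const.
    apply Hf. set (p := (x, y) : C). replace (p + z0 - z0) with p by ring. unfold p.
    eapply Rle_lt_trans. apply Cmod_2Rmax. simpl.
    assert (Rmax (Rabs x) (Rabs y) <= r)%R by (apply Rmax_lub; apply Rabs_le; lra).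
    assert (0 <= Rmax (Rabs x) (Rabs y))%R by (eapply Rle_trans; [apply Rabs_pos|apply Rmax_l]).
    assert (Hs : (0 < sqrt 2 < 2)%R).
    { split. apply sqrt_lt_R0; lra. rewrite <- (sqrt_square 2) at 2 by lra. apply sqrt_lt_1; lra. }
    nra.
  - exists c. split; auto. intros z Hz. rewrite <- H by auto. f_equal. ring.
Qed.

(** The expansions on the various discs have the same coefficients by the identity
    theorem. *)
Lemma power_series_entire (f : C -> C) : (forall z, cdiff f z) ->
  exists c, (forall r, (0 < r)%R -> power_bounded c r) /\ forall z, f z = germ_sum c z.
Proof.
  intros Hf.
  assert (K : forall r, (0 < r)%R -> exists c, power_bounded c r /\
    forall z, (Cmod z < r)%R -> f z = germ_sum c z).
  { intros r Hr. destruct (power_series_disc f 0 r Hr) as [c [Hc H]]; auto.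
    exists c. split; auto. intros z Hz. replace z with (z - 0) at 2 by ring. apply H.
    now replace (z - 0) with z by ring. }
  destruct (K 1%R ltac:(lra)) as [c [Hc H]].
  assert (E : forall r, (1 <= r)%R -> power_bounded c r /\ forall z, (Cmod z < r)%R -> f z = germ_sum c z).
  { intros r Hr. destruct (K r ltac:(lra)) as [d [Hd H']].
    assert (Ecd : forall n, d n = c n).
    { apply germ_sum_identity with 1%R; auto. lra. apply power_bounded_le with r; auto. lra.
      exists 1%R. split. lra. intros y Hy. replace (y - 0) with y in Hy by ring.
      rewrite <- H, <- H'; auto. lra. }
    split. now apply power_bounded_ext with d. intros z Hz. rewrite H' by auto. now apply germ_sum_ext. }
  exists c. split.
  - intros r Hr. apply power_bounded_le with (Rmax 1 r). split. lra. apply Rmax_r. apply E. apply Rmax_l.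
  - intros z. apply (E (1 + Cmod z)%R). pose proof (Cmod_ge_0 z). lra. lra.
Qed.

(** * Taylor coefficients at a pole *)

(** The term of index [-1] is taken to be zero, so that the difference corresponds to
    multiplication by [1 - z] and partial summation inverts it. *)
Definition nabla (u : nat -> C) (n : nat) : C :=
  match n with O => u 0%nat | S m => u (S m) - u m end.

Lemma psum_nabla (u : nat -> C) (n : nat) : psum (nabla u) (S n) = u n.
Proof. induction n. simpl; ring. cbn [psum] in *. rewrite IHn. simpl. ring. Qed.

Lemma power_bounded_nabla (u : nat -> C) (r : R) : (0 <= r)%R -> power_bounded u r ->
  power_bounded (nabla u) r.
Proof.
  intros Hr Hu. destruct (power_bounded_pos _ _ Hu) as [M [HM H]].
  exists (M + r * M)%R. intros [|n].
  - pose proof (H 0%nat). cbn [nabla]. nra.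
  - pose proof (H (S n)) as H1. pose proof (H n) as H2. cbn [nabla].
    apply Rle_trans with ((Cmod (u (S n)) + Cmod (u n)) * r ^ S n)%R.
    apply Rmult_le_compat_r. now apply pow_le. apply Cmod_triangle_minus.
    simpl in *. nra.
Qed.

Lemma germ_sum_nabla (u : nat -> C) (r : R) (z : C) : power_bounded u r -> (Cmod z < r)%R ->
  germ_sum (nabla u) z = (1 - z) * germ_sum u z.
Proof.
  intros Hu Hz. assert (0 < r)%R by (pose proof (Cmod_ge_0 z); lra).
  rewrite (germ_sum_S (nabla u) r) by (auto; apply power_bounded_nabla; auto; lra).
  cbn [nabla].
  rewrite (germ_sum_ext (fun n => u (S n) - u n) (fun n => u (S n) + - (1) * u n)) by (intros; ring).
  rewrite (germ_sum_plus _ _ r), (germ_sum_scal _ _ r) by (auto; try apply power_bounded_scal; auto; now apply power_bounded_S).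
  rewrite (germ_sum_S u r z Hu Hz). ring.
Qed.

Lemma iter_nabla_power_bounded (k : nat) (u : nat -> C) (r : R) : (0 <= r)%R -> power_bounded u r ->
  power_bounded (Nat.iter k nabla u) r.
Proof. intros Hr Hu. induction k; simpl; auto. now apply power_bounded_nabla. Qed.

Lemma germ_sum_iter_nabla (k : nat) (u : nat -> C) (r : R) (z : C) : power_bounded u r ->
  (Cmod z < r)%R ->
  germ_sum (Nat.iter k nabla u) z = (1 - z) ^ k * germ_sum u z.
Proof.
  intros Hu Hz. assert (0 < r)%R by (pose proof (Cmod_ge_0 z); lra).
  induction k; simpl. ring.
  rewrite (germ_sum_nabla _ r); auto. rewrite IHk. ring. apply iter_nabla_power_bounded; auto. lra.
Qed.

Lemma psum_S_l (u : nat -> C) (n : nat) : psum u (S n) = u 0%nat + psum (fun k => u (S k)) n.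
Proof. induction n. simpl; ring. change (psum u (S (S n))) with (psum u (S n) + u (S n)). rewrite IHn. simpl; ring. Qed.

Lemma psum_ext (u v : nat -> C) (n : nat) : (forall k, (k < n)%nat -> u k = v k) ->
  psum u n = psum v n.
Proof. intros H. induction n; simpl; auto. rewrite IHn, H; auto. Qed.

Lemma psum_plus (u v : nat -> C) (n : nat) :
  psum (fun k => u k + v k) n = psum u n + psum v n.
Proof. induction n; simpl. ring. rewrite IHn. ring. Qed.

Lemma psum_scal (x : C) (u : nat -> C) (n : nat) : psum (fun k => x * u k) n = x * psum u n.
Proof. induction n; simpl. ring. rewrite IHn. ring. Qed.

Lemma psum_swap (u : nat -> nat -> C) (m n : nat) :
  psum (fun i => psum (u i) n) m = psum (fun j => psum (fun i => u i j) m) n.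
Proof.
  induction m; simpl.
  - induction n; simpl; auto. rewrite <- IHn. ring.
  - rewrite IHm, <- psum_plus. reflexivity.
Qed.

Lemma psum_0 (u : nat -> C) (n : nat) : (forall k, (k < n)%nat -> u k = 0) -> psum u n = 0.
Proof. intros H. induction n; simpl; auto. rewrite IHn, H; auto. ring. Qed.

Fixpoint falling (n j : nat) : C :=
  match j with O => 1 | S j => falling n j * (INR n - INR j) end.

Lemma falling_S_S (n j : nat) : falling (S n) (S j) = INR (S n) * falling n j.
Proof.
  induction j. cbn [falling]. change (INR 0) with 0%R. ring.
  change (falling (S n) (S (S j))) with (falling (S n) (S j) * (INR (S n) - INR (S j))).
  rewrite IHj. cbn [falling]. rewrite !S_INR, !RtoC_plus. ring.
Qed.

Lemma falling_0_S (j : nat) : falling 0 (S j) = 0.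
Proof. induction j. simpl; ring. change (falling 0 (S (S j))) with (falling 0 (S j) * (INR 0 - INR (S j))). rewrite IHj; ring. Qed.

Lemma INR_S_neq0 (j : nat) : RtoC (INR (S j)) <> 0.
Proof. intros E. apply RtoC_inj in E. now apply (not_0_INR (S j)). Qed.

(** Summation of falling factorials. The closed form is the falling factorial of order
    [S j] at [S n] divided by [S j], rewritten with falling factorials at [n]. *)
Lemma psum_falling (n j : nat) :
  psum (fun i => falling i j) (S n) = falling n (S j) / INR (S j) + falling n j.
Proof.
  pose proof (INR_S_neq0 j) as Hj.
  assert (E : forall n, falling n (S j) / INR (S j) + falling n j = falling (S n) (S j) / INR (S j)).
  { intros k. rewrite falling_S_S. cbn [falling].
    replace (RtoC (INR (S k))) with ((INR k - INR j) + INR (S j)).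
    field. exact Hj. rewrite !S_INR, !RtoC_plus. ring. }
  rewrite E. induction n.
  - rewrite falling_S_S. cbn [psum]. simpl (INR 1). destruct j.
    + simpl. field.
    + rewrite falling_0_S. field; exact Hj.
  - change (psum (fun i => falling i j) (S (S n))) with (psum (fun i => falling i j) (S n) + falling (S n) j).
    rewrite IHn, <- (E (S n)). ring.
Qed.

(** The coefficient sequences of entire functions. *)
Definition entire_coef (e : nat -> C) : Prop := forall r : R, (0 < r)%R -> power_bounded e r.

Lemma is_Cseries_drop (u : nat -> C) (l : C) (N : nat) : is_Cseries u l ->
  is_Cseries (fun i => u (N + i)%nat) (l - psum u N).
Proof.
  intros H. induction N.
  - simpl. replace (l - 0) with l by ring. exact H.
  - destruct IHN as [H1 H2].
    apply is_Cseries_ext with (fun i => u (N + S i)%nat). { intros; f_equal; lia. }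
    cbn [psum]. split.
    + apply (is_series_incr_1 (fun i => Re (u (N + i)%nat))). rewrite Nat.add_0_r.
      match goal with |- is_series _ ?x => replace x with (Re (l - psum u N)) end. exact H1.
      generalize (psum u N) (u N). intros p q. destruct p, q, l.
      unfold plus, Cminus, Cplus, Copp, Re, Im; simpl. ring.
    + apply (is_series_incr_1 (fun i => Im (u (N + i)%nat))). rewrite Nat.add_0_r.
      match goal with |- is_series _ ?x => replace x with (Im (l - psum u N)) end. exact H2.
      generalize (psum u N) (u N). intros p q. destruct p, q, l.
      unfold plus, Cminus, Cplus, Copp, Re, Im; simpl. ring.
Qed.

(** The error is a tail of the series of [psi], which decays as fast as [psi]. *)
Lemma entire_coef_psum (psi : nat -> C) : entire_coef psi ->
  exists e, entire_coef e /\ forall n, psum psi (S n) = germ_sum psi 1 + e n.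
Proof.
  intros Hpsi. exists (fun n => - (germ_sum psi 1 - psum psi (S n))). split.
  2: { intros; ring. }
  intros r Hr. set (R0 := (2 * r + 2)%R).
  destruct (power_bounded_pos _ _ (Hpsi R0 ltac:(unfold R0; lra))) as [M [HM H]].
  assert (HR0 : (2 < R0)%R) by (unfold R0; lra).
  assert (HS : is_Cseries psi (germ_sum psi 1)).
  { apply is_Cseries_ext with (fun n => psi n * 1 ^ n). intros n. rewrite Cpow_1_l. ring.
    apply germ_sum_is_Cseries with R0. apply Hpsi; lra. rewrite Cmod_1; lra. }
  assert (Hq : (0 < / R0 < 1/2)%R).
  { split. apply Rinv_0_lt_compat; lra. replace (1/2)%R with (/2)%R by lra. apply Rinv_lt_contravar; lra. }
  exists (4 * M)%R. intros n. rewrite Cmod_opp.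
  assert (K : (Cmod (germ_sum psi 1 - psum psi (S n)) <= 2 * Series (fun i => M * / R0 ^ S n * (/ R0) ^ i))%R).
  { apply is_Cseries_le with (1 := is_Cseries_drop psi _ (S n) HS).
    - intros i. specialize (H (S n + i)%nat). rewrite pow_inv, Rmult_assoc, <- Rinv_mult, <- pow_add.
      apply -> Rle_div_r. exact H. apply pow_lt; lra.
    - apply (ex_series_scal_l (M * / R0 ^ S n)%R (fun i => (/R0) ^ i)%R). apply ex_series_geom.
      rewrite Rabs_pos_eq; lra. }
  rewrite Series_scal_l, Series_geom in K by (rewrite Rabs_pos_eq; lra).
  assert (Hp : (0 < R0 ^ n)%R) by (apply pow_lt; lra).
  apply Rle_trans with (2 * (M * / R0 ^ S n * / (1 - / R0)) * R0 ^ n)%R.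
  - apply Rmult_le_compat. apply Cmod_ge_0. apply pow_le; lra. exact K.
    apply pow_incr. unfold R0; lra.
  - replace (2 * (M * / R0 ^ S n * / (1 - / R0)) * R0 ^ n)%R with (2 * M * / (R0 - 1))%R.
    2: { simpl. field. repeat split; lra. }
    assert (/ (R0 - 1) <= 1)%R. { rewrite <- Rinv_1. apply Rinv_le_contravar; lra. }
    assert (0 < / (R0 - 1))%R by (apply Rinv_0_lt_compat; lra). nra.
Qed.

(** Summation raises the degree by one and divides the leading coefficient by the new
    degree, so it stays non-zero. The coefficients beyond the degree are kept zero to
    make the shifted sequences addable. *)
Lemma iter_nabla_entire_coef (m : nat) : forall (psi u : nat -> C), entire_coef psi ->
  germ_sum psi 1 <> 0 -> (forall n, Nat.iter (S m) nabla u n = psi n) ->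
  exists q e : nat -> C, entire_coef e /\ q m <> 0 /\ (forall j, (m < j)%nat -> q j = 0) /\
    forall n, u n = psum (fun j => q j * falling n j) (S m) + e n.
Proof.
  induction m; intros psi u Hpsi Hs Hu.
  - destruct (entire_coef_psum psi Hpsi) as [e [He E]].
    exists (fun j => match j with O => germ_sum psi 1 | _ => 0 end), e.
    repeat split; auto. intros [|j] Hj; auto. lia.
    intros n. rewrite <- (psum_nabla u). rewrite (psum_ext _ psi); auto. rewrite E. simpl. ring.
  - destruct (IHm psi (nabla u) Hpsi Hs) as (q & e & He & Hqm & Hq0 & E).
    { intros n. rewrite <- Hu. rewrite (Nat.iter_swap (S m) _ nabla u). reflexivity. }
    destruct (entire_coef_psum e He) as [e' [He' E']].
    exists (fun j => q j + match j with O => germ_sum e 1 | S i => q i / INR (S i) end), e'.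
    split; [auto|]. split; [|split].
    + rewrite (Hq0 (S m)) by lia. intros H. apply Hqm. pose proof (INR_S_neq0 m) as Hm.
      replace (q m) with ((0 + q m / INR (S m)) * INR (S m)) by (field; exact Hm). rewrite H. ring.
    + intros [|j] Hj. lia. rewrite (Hq0 (S j)), (Hq0 j) by lia.
      pose proof (INR_S_neq0 j). field. auto.
    + intros n. rewrite <- (psum_nabla u).
      rewrite (psum_ext (nabla u) (fun i => psum (fun j => q j * falling i j) (S m) + e i)) by (intros; apply E).
      rewrite psum_plus, E', psum_swap.
      rewrite (psum_ext _ (fun j => q j * falling n j + q j / INR (S j) * falling n (S j))).
      2: { intros j _. rewrite psum_scal, psum_falling. pose proof (INR_S_neq0 j). field. auto. }
      rewrite psum_plus.
      rewrite (psum_ext (fun j => (q j + match j with O => germ_sum e 1 | S i => q i / INR (S i) end) * falling n j)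
        (fun j => q j * falling n j + (match j with O => germ_sum e 1 | S i => q i / INR (S i) end) * falling n j))
        by (intros; ring).
      rewrite psum_plus.
      rewrite (psum_S_l (fun j => match j with O => germ_sum e 1 | S i => q i / INR (S i) end * falling n j)).
      change (psum (fun j => q j * falling n j) (S (S m))) with (psum (fun j => q j * falling n j) (S m) + q (S m) * falling n (S m)).
      rewrite (Hq0 (S m)) by lia. cbn [falling]. ring.
Qed.

Lemma power_bounded_rescale (a : nat -> C) (w : C) (r : R) : w <> 0 -> power_bounded a r ->
  power_bounded (fun n => a n * w ^ n) (r / Cmod w).
Proof.
  intros Hw [M H]. assert (Hm : (0 < Cmod w)%R) by now apply Cmod_gt_0.
  exists M. intros n. rewrite Cmod_mult, Cmod_pow, Rmult_assoc, <- Rpow_mult_distr.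
  replace (Cmod w * (r / Cmod w))%R with r by (field; lra). apply H.
Qed.

Lemma germ_sum_rescale (a : nat -> C) (w z : C) :
  germ_sum (fun n => a n * w ^ n) z = germ_sum a (w * z).
Proof.
  unfold germ_sum. f_equal; apply Series_ext; intros n; rewrite Cpow_mult_l; f_equal; ring.
Qed.

(** [F (w z)] times [(1 - z) ^ S m] is entire, and its Taylor coefficients are the
    iterated differences of those of [F (w z)]. *)
Lemma pole_coefficients (w : C) (F : C -> C) (a : nat -> C) : w <> 0 -> meromorphic F ->
  pole F w -> (forall z, pole F z -> z = w) -> germ_of F a ->
  exists (m : nat) (q e : nat -> C), entire_coef e /\ q m <> 0 /\
    forall n, a n * w ^ n = psum (fun j => q j * falling n j) (S m) + e n.
Proof.
  intros Hw HF (k & h & Hk & Hh & Hh0 & HFh) Honly [Ha HFa].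
  assert (Hwm : (0 < Cmod w)%R) by now apply Cmod_gt_0.
  destruct k as [|m]; [lia|]. exists m.
  set (Phi := fun z => if Ceq_dec z 1 then h w / (- w) ^ S m else (1 - z) ^ S m * F (w * z)).
  assert (Hwk : (- w) ^ S m <> 0).
  { apply Cpow_nz. intros E. apply Hw. replace w with (- - w) by ring. rewrite E. ring. }
  assert (Hlin : forall z, cdiff (fun z => w * z) z).
  { intros z. apply cdiff_mult. apply cdiff_const. apply cdiff_id. }
  assert (HPhi : forall z, cdiff Phi z).
  { intros z. destruct (Ceq_dec z 1) as [->|Hz].
    - apply near_locally in HFh. apply near_locally in Hh.
      destruct (near_and _ _ _ HFh Hh) as [d [Hd K]].
      apply cdiff_ext_near with (fun z => h (w * z) * / (- w) ^ S m).
      + exists (d / Cmod w)%R. split. now apply Rdiv_lt_0_compat.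
        intros y Hy. unfold Phi. destruct (Ceq_dec y 1) as [->|n]. now rewrite Cmult_1_r.
        assert (Hyw : w * y - w = (- w) * (1 - y)) by ring.
        assert (H1y : 1 - y <> 0) by (apply Cminus_neq0; congruence).
        destruct (K (w * y)) as [K1 _].
        * replace (w * y - w) with (w * (y - 1)) by ring. rewrite Cmod_mult.
          rewrite Rmult_comm. now apply Rlt_div_r.
        * rewrite K1, Hyw, Cpow_mult_l. field. split; auto. now apply Cpow_nz.
          intros E. apply n. apply Cminus_eq0.
          assert (E2 : w * (y - 1) = w * 0) by (replace (w * (y - 1)) with (w * y - w) by ring; rewrite E; ring).
          replace (y - 1) with (w * (y - 1) / w) by now field. rewrite E2. now field.
      + apply cdiff_mult; [|apply cdiff_const]. apply (cdiff_comp (fun z => w * z) h). apply Hlin.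
        rewrite Cmult_1_r. apply ex_derive_cdiff. apply (K w).
        replace (w - w) with (RtoC 0) by ring. now rewrite Cmod_0.
    - apply cdiff_ext_near with (fun z => (1 - z) ^ S m * F (w * z)).
      + apply near_imp with (2 := near_neq _ _ Hz). intros y Hy. unfold Phi.
        destruct (Ceq_dec y 1); congruence.
      + apply cdiff_mult. apply cdiff_pow. apply cdiff_minus. apply cdiff_const. apply cdiff_id.
        apply (cdiff_comp (fun z => w * z) F). apply Hlin.
        destruct (HF (w * z)) as [H|H].
        * apply near_locally in H. apply near_self in H. now apply ex_derive_cdiff.
        * apply Honly in H. exfalso. apply Hz. replace z with (w * z / w) by now field.
          rewrite H. now field. }
  destruct (power_series_entire Phi HPhi) as [psi [Hpsi HPsi]].
  destruct (iter_nabla_entire_coef m psi (fun n => a n * w ^ n)) as (q & e & He & Hq & _ & E);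
    [| | |now exists q, e].
  - exact Hpsi.
  - rewrite <- HPsi. unfold Phi. destruct (Ceq_dec 1 1); [|congruence].
    intros E. apply Hh0. replace (h w) with (h w / (- w) ^ S m * (- w) ^ S m) by now field.
    rewrite E. ring.
  - destruct (convergent_germ_power_bounded a Ha) as [r [Hr Har]].
    assert (Hr' : (0 < r / Cmod w)%R) by now apply Rdiv_lt_0_compat.
    pose proof (power_bounded_rescale a w r Hw Har) as Hbd.
    apply germ_sum_identity with (r / Cmod w)%R; auto.
    + apply iter_nabla_power_bounded; auto. lra.
    + apply near_locally in HFa.
      destruct HFa as [d [Hd K]].
      exists (Rmin (Rmin (d / Cmod w) (r / Cmod w)) 1). split.
      { repeat apply Rmin_glb_lt; auto. now apply Rdiv_lt_0_compat. lra. }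
      intros z Hz. replace (z - 0) with z in Hz by ring.
      assert (H1 : (Cmod z < d / Cmod w)%R).
      { eapply Rlt_le_trans. exact Hz. eapply Rle_trans; [apply Rmin_l|apply Rmin_l]. }
      assert (H2 : (Cmod z < r / Cmod w)%R).
      { eapply Rlt_le_trans. exact Hz. eapply Rle_trans; [apply Rmin_l|apply Rmin_r]. }
      assert (H3 : (Cmod z < 1)%R) by (eapply Rlt_le_trans; [exact Hz|apply Rmin_r]).
      rewrite (germ_sum_iter_nabla _ _ (r / Cmod w)) by auto.
      rewrite germ_sum_rescale, <- HPsi. unfold Phi.
      destruct (Ceq_dec z 1) as [->|_]. rewrite Cmod_1 in H3. lra.
      f_equal. symmetry. apply K. replace (w * z - 0) with (w * z) by ring.
      rewrite Cmod_mult, Rmult_comm. now apply Rlt_div_r.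
Qed.

(** * The differential equation of the Hadamard inverse *)

(** The coefficients of [z^j G^(j)(z)], where [G] has the coefficients [b]. *)
Definition zderiv_seq (b : nat -> C) (j n : nat) : C := falling n j * b n.

Lemma zderiv_seq_theta (b : nat -> C) (j n : nat) :
  theta_seq (zderiv_seq b j) n = INR j * zderiv_seq b j n + zderiv_seq b (S j) n.
Proof. unfold theta_seq, zderiv_seq. cbn [falling]. ring. Qed.

Lemma power_bounded_zderiv_seq (b : nat -> C) (r : R) (j : nat) : power_bounded b r ->
  forall s, (0 <= s < r)%R -> power_bounded (zderiv_seq b j) s.
Proof.
  intros Hb. induction j; intros s Hs.
  - apply power_bounded_ext with b. intros n. unfold zderiv_seq. simpl. ring. apply power_bounded_le with r; auto. lra.
  - apply power_bounded_ext with (fun n => theta_seq (zderiv_seq b j) n + (- INR j) * zderiv_seq b j n).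
    { intros n. rewrite zderiv_seq_theta. ring. }
    apply power_bounded_plus. lra. apply power_bounded_theta_seq with ((s + r) / 2)%R. lra. apply IHj. lra.
    apply power_bounded_scal. now apply IHj.
Qed.

Lemma germ_sum_zderiv_seq (j : nat) : forall (b : nat -> C) (r : R) (z : C), power_bounded b r ->
  (Cmod z < r)%R ->
  z ^ j * germ_sum (Nat.iter j deriv_seq b) z = germ_sum (zderiv_seq b j) z.
Proof.
  induction j; intros b r z Hb Hz; pose proof (Cmod_ge_0 z).
  - simpl. rewrite (germ_sum_ext (zderiv_seq b 0) b). ring. intros n. unfold zderiv_seq. simpl. ring.
  - rewrite (germ_sum_S (zderiv_seq b (S j)) ((Cmod z + r) / 2)); [|apply power_bounded_zderiv_seq with r; auto; lra|lra].
    unfold zderiv_seq at 1. rewrite falling_0_S.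
    rewrite (germ_sum_ext (fun n => zderiv_seq b (S j) (S n)) (zderiv_seq (deriv_seq b) j)).
    2: { intros n. unfold zderiv_seq, deriv_seq. rewrite falling_S_S. ring. }
    rewrite <- (IHj (deriv_seq b) ((Cmod z + r) / 2)%R); [|apply power_bounded_deriv_seq with r; auto; lra|lra].
    rewrite (Nat.iter_succ_r j _ deriv_seq b). rewrite Cpow_S. ring.
Qed.

Lemma iter_deriv_seq_power_bounded (b : nat -> C) (r : R) (j : nat) : power_bounded b r ->
  forall s, (0 < s < r)%R -> power_bounded (Nat.iter j deriv_seq b) s.
Proof.
  intros Hb. induction j; intros s Hs.
  - simpl. apply power_bounded_le with r; auto. lra.
  - simpl. apply power_bounded_deriv_seq with ((s + r) / 2)%R. lra. apply IHj. lra.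
Qed.

Lemma iter_C_derive (b : nat -> C) (r : R) (j : nat) : power_bounded b r ->
  forall z, (Cmod z < r)%R -> Nat.iter j C_derive (germ_sum b) z = germ_sum (Nat.iter j deriv_seq b) z.
Proof.
  intros Hb. induction j; intros z Hz; simpl; auto.
  pose proof (Cmod_ge_0 z).
  apply C_derive_cder. apply cder_ext_near with (germ_sum (Nat.iter j deriv_seq b)).
  - apply near_imp with (2 := near_ball 0 z r ltac:(now replace (z - 0) with z by ring)).
    intros y Hy. symmetry. apply IHj. now replace (y - 0) with y in Hy by ring.
  - apply germ_sum_cder with ((Cmod z + r) / 2)%R. apply iter_deriv_seq_power_bounded with r; auto. lra. lra.
Qed.

Lemma power_bounded_psum (q : nat -> C) (u : nat -> nat -> C) (r : R) (k : nat) : (0 <= r)%R ->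
  (forall j, (j < k)%nat -> power_bounded (u j) r) -> power_bounded (fun n => psum (fun j => q j * u j n) k) r.
Proof.
  intros Hr H. induction k.
  - exists 0%R. intros n. simpl. rewrite Cmod_0. lra.
  - simpl. apply (power_bounded_plus _ (fun n => q k * u k n)); auto. apply power_bounded_scal. apply H. lia.
Qed.

Lemma germ_sum_psum (q : nat -> C) (u : nat -> nat ->
  C) (r : R) (z : C) (k : nat) : (Cmod z < r)%R ->
  (forall j, (j < k)%nat -> power_bounded (u j) r) ->
  germ_sum (fun n => psum (fun j => q j * u j n) k) z = psum (fun j => q j * germ_sum (u j) z) k.
Proof.
  intros Hz H. pose proof (Cmod_ge_0 z). induction k.
  - simpl. apply germ_sum_eq. apply is_Cseries_lim with (fun _ => 0%R). 2: apply is_lim_seq_const.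
    intros n. rewrite psum_0. replace (0 - 0) with (RtoC 0) by ring. rewrite Cmod_0. lra.
    intros k _. ring.
  - simpl. rewrite <- IHk by auto.
    rewrite (germ_sum_plus (fun n => psum (fun j => q j * u j n) k) (fun n => q k * u k n) r); auto.
    rewrite (germ_sum_scal _ _ r); auto.
    apply power_bounded_psum; auto. lra. apply power_bounded_scal; auto.
Qed.

(** The geometric growth of [b] is absorbed by evaluating the bound on [e] at a larger
    radius. *)
Lemma entire_coef_mult (e b : nat -> C) (r : R) : (0 < r)%R -> entire_coef e -> power_bounded b r ->
  entire_coef (fun n => e n * b n).
Proof.
  intros Hr He Hb s Hs.
  destruct (power_bounded_pos _ _ (He (s / r)%R ltac:(now apply Rdiv_lt_0_compat))) as [M [HM HeM]].
  destruct (power_bounded_pos _ _ Hb) as [N [HN HbN]].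
  exists (M * N)%R. intros n.
  rewrite Cmod_mult. replace (s ^ n)%R with ((s / r) ^ n * r ^ n)%R.
  - replace (Cmod (e n) * Cmod (b n) * ((s / r) ^ n * r ^ n))%R
      with ((Cmod (e n) * (s / r) ^ n) * (Cmod (b n) * r ^ n))%R by ring.
    apply Rmult_le_compat; auto; apply Rmult_le_pos; try apply Cmod_ge_0; apply pow_le.
    apply Rdiv_le_0_compat; lra. lra.
  - rewrite <- Rpow_mult_distr. f_equal. field. lra.
Qed.

Lemma power_bounded_geom (w : C) (r : R) : (0 <= r)%R -> power_bounded (fun n => w ^ n) r ->
  (Cmod w * r <= 1)%R.
Proof.
  intros Hr [M H]. apply Rnot_lt_le. intros Hlt.
  destruct (Pow_x_infinity (Cmod w * r)%R) with (b := (M + 1)%R) as [N HN].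
  { rewrite Rabs_pos_eq; lra. }
  specialize (HN N (le_n _)). specialize (H N). rewrite Cmod_pow, <- Rpow_mult_distr in H.
  rewrite Rabs_pos_eq in HN. lra. apply pow_le. lra.
Qed.

(** The expansion of [pole_coefficients] multiplied by [b n], as [a n * b n = 1]. *)
Lemma hadamard_inverse_coefficients (w : C) (F : C -> C) (a b : nat -> C) : w <> 0 ->
  meromorphic F -> pole F w -> (forall z, pole F z -> z = w) -> germ_of F a ->
  hadamard_inverse a b ->
  exists (m : nat) (q e : nat -> C), entire_coef e /\ q m <> 0 /\
    forall n, psum (fun j => q j * zderiv_seq b j n) (S m) + e n * b n = w ^ n.
Proof.
  intros Hw HF Hpole Honly Ha [Hb [Hab Hone]].
  destruct (pole_coefficients w F a Hw HF Hpole Honly Ha) as (m & q & e & He & Hq & E).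
  exists m, q, e. split; [auto|]. split; [auto|]. intros n.
  destruct (convergent_germ_power_bounded _ Hab) as [r [Hr Habr]].
  assert (H1 : hadamard a b n = 1 ^ n).
  { apply germ_sum_identity with (d := fun n => 1 ^ n) (r := Rmin r 1).
    - apply Rmin_glb_lt; lra.
    - apply power_bounded_le with r; auto. split; [apply Rmin_glb; lra|apply Rmin_l].
    - exists 1%R. intros k. rewrite Cpow_1_l, Cmod_1, Rmult_1_l.
      apply Rle_trans with (1 ^ k)%R; [|rewrite pow1; lra]. apply pow_incr. split; [apply Rmin_glb; lra|apply Rmin_r].
    - apply near_locally in Hone. destruct Hone as [d [Hd K]].
      exists (Rmin d 1). split. apply Rmin_glb_lt; lra. intros z Hz.
      rewrite <- K by (eapply Rlt_le_trans; [exact Hz|apply Rmin_l]).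
      rewrite germ_sum_geom. now rewrite Cmult_1_l.
      rewrite Cmult_1_l. replace z with (z - 0) by ring.
      eapply Rlt_le_trans; [exact Hz|apply Rmin_r]. }
  rewrite Cpow_1_l in H1. unfold hadamard in H1.
  replace (w ^ n) with (a n * w ^ n * b n).
  2: { replace (a n * w ^ n * b n) with (a n * b n * w ^ n) by ring. rewrite H1. ring. }
  rewrite E. unfold zderiv_seq.
  rewrite (psum_ext _ (fun j => b n * (q j * falling n j))) by (intros; ring).
  rewrite psum_scal. ring.
Qed.

Definition ode_right (w : C) (h : nat -> C) (z : C) : C := 1 / (1 - w * z) - germ_sum h z.

Lemma entire_coef_germ_sum_cdiff (h : nat -> C) (z : C) : entire_coef h -> cdiff (germ_sum h) z.
Proof.
  intros Hh. pose proof (Cmod_ge_0 z).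
  apply germ_sum_cdiff with (Cmod z + 1)%R. apply Hh. lra. lra.
Qed.

Lemma one_minus_neq0 (w z : C) : w <> 0 -> z <> / w -> 1 - w * z <> 0.
Proof.
  intros Hw Hz E. apply Hz. replace (/ w) with ((1 - (1 - w * z)) / w).
  now field. rewrite E. now field.
Qed.

Lemma ode_right_cdiff (w z : C) (h : nat -> C) : w <> 0 -> entire_coef h -> z <> / w ->
  cdiff (ode_right w h) z.
Proof.
  intros Hw Hh Hz. apply cdiff_minus; [|now apply entire_coef_germ_sum_cdiff].
  apply cdiff_div. apply cdiff_const.
  apply cdiff_minus. apply cdiff_const. apply cdiff_mult. apply cdiff_const. apply cdiff_id.
  now apply one_minus_neq0.
Qed.

(** The right-hand side inherits the pole of the geometric series at [/ w], as the
    correction is entire. *)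
Lemma ode_right_neq0 (w : C) (h : nat -> C) : w <> 0 -> entire_coef h ->
  exists z : C, ~ (z = 0 \/ z = / w) /\ ode_right w h z <> 0.
Proof.
  intros Hw Hh. assert (Hwm : (0 < Cmod w)%R) by now apply Cmod_gt_0.
  destruct (cdiff_ccont _ _ (entire_coef_germ_sum_cdiff h (/ w) Hh) 1%R ltac:(lra)) as [d [Hd K]].
  set (B := (Cmod (germ_sum h (/ w)) + 1)%R).
  assert (HB : (1 <= B)%R) by (pose proof (Cmod_ge_0 (germ_sum h (/ w))); unfold B; lra).
  (* at [(1 - s) / w] the geometric series is [1 / s >= B], where [B] bounds the entire
     part near [/ w]; [s < 1] keeps the point away from [0] *)
  set (s := Rmin (Rmin (1/2) (d * Cmod w / 2)) (/ B)).
  assert (Hs0 : (0 < s)%R).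
  { repeat apply Rmin_glb_lt. lra. assert (0 < d * Cmod w)%R by now apply Rmult_lt_0_compat. lra.
    apply Rinv_0_lt_compat; lra. }
  assert (Hs1 : (s <= 1/2)%R) by (eapply Rle_trans; [apply Rmin_l|apply Rmin_l]).
  assert (Hs2 : (s <= d * Cmod w / 2)%R) by (eapply Rle_trans; [apply Rmin_l|apply Rmin_r]).
  assert (Hs3 : (s <= / B)%R) by apply Rmin_r.
  assert (Hsc : RtoC s <> 0) by (intros E; apply RtoC_inj in E; lra).
  assert (Hsm : Cmod s = s) by (rewrite Cmod_R, Rabs_pos_eq; lra).
  assert (Ez : 1 - w * ((1 - s) / w) = s) by now field.
  exists ((1 - s) / w). split.
  - intros [E|E]; rewrite E in Ez.
    + assert (E' : RtoC s = 1) by (rewrite <- Ez; ring). apply RtoC_inj in E'. lra.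
    + apply Hsc. rewrite <- Ez. now field.
  - unfold ode_right. rewrite Ez. intros E. apply Cminus_eq0 in E.
    assert (Hlt : (Cmod (germ_sum h ((1 - s) / w)) < B)%R).
    { assert (K' : (Cmod (germ_sum h ((1 - s) / w) - germ_sum h (/ w)) < 1)%R).
      { apply K. replace ((1 - s) / w - / w) with (- (s / w)) by now field.
        rewrite Cmod_opp, Cmod_div, Hsm by auto. apply <- Rlt_div_l; [|lra].
        assert (0 < d * Cmod w)%R by now apply Rmult_lt_0_compat. lra. }
      pose proof (Cmod_rev (germ_sum h ((1 - s) / w)) (germ_sum h (/ w))). unfold B. lra. }
    rewrite <- E, Cmod_div, Cmod_1, Hsm in Hlt by auto.
    assert (B <= 1 / s)%R; [|lra].
    apply -> Rle_div_r; [|lra]. replace 1%R with (B * / B)%R by (field; lra).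
    apply Rmult_le_compat_l; lra.
Qed.

(** The previous relation between coefficients, summed over the disc of convergence of
    [b]. The geometric series converges there, because its coefficients are sums of
    sequences that are [power_bounded] beyond [|z|]. *)
Lemma germ_sum_equation (w : C) (m : nat) (q e b : nat -> C) (z : C) : w <> 0 -> entire_coef e ->
  (forall n, psum (fun j => q j * zderiv_seq b j n) (S m) + e n * b n = w ^ n) ->
  convergence_disc b z ->
  psum (fun j => q j * germ_sum (zderiv_seq b j) z) (S m) = ode_right w (fun n => e n * b n) z.
Proof.
  intros Hw He E Hz. pose proof (Cmod_ge_0 z).
  destruct (convergence_disc_power_bounded b z Hz) as [r [Hr Hb]].
  set (s := ((Cmod z + r) / 2)%R). assert (Hs : (Cmod z < s < r)%R) by (unfold s; lra).
  assert (Hf : forall j, power_bounded (zderiv_seq b j) s) by (intros; apply power_bounded_zderiv_seq with r; auto; lra).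
  assert (Hh : entire_coef (fun n => e n * b n)) by (apply entire_coef_mult with r; auto; lra).
  assert (Hp : power_bounded (fun n => psum (fun j => q j * zderiv_seq b j n) (S m)) s) by (apply power_bounded_psum; auto; lra).
  assert (Hhs : power_bounded (fun n => e n * b n) s) by (apply Hh; lra).
  assert (Hwz : (Cmod (w * z) < 1)%R).
  { assert (Hg : (Cmod w * s <= 1)%R).
    { apply power_bounded_geom. lra. apply power_bounded_ext with (1 := E). apply power_bounded_plus; auto. lra. }
    assert (0 < Cmod w)%R by now apply Cmod_gt_0. rewrite Cmod_mult.
    eapply Rlt_le_trans; [|exact Hg]. apply Rmult_lt_compat_l; lra. }
  unfold ode_right. rewrite <- germ_sum_geom by auto.
  rewrite (germ_sum_ext (fun n => w ^ n)
    (fun n => psum (fun j => q j * zderiv_seq b j n) (S m) + e n * b n)) by (intros; now rewrite E).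
  rewrite (germ_sum_plus _ _ s) by (auto; lra).
  rewrite (germ_sum_psum q (zderiv_seq b) s) by (auto; lra). ring.
Qed.

Definition inverse_ode (w : C) (m : nat) (q h : nat -> C) : linear_ode :=
  LinearODE m (fun j z => q j * z ^ j) (ode_right w h).

Lemma inverse_ode_solves (w : C) (m : nat) (q e b : nat -> C) : w <> 0 -> entire_coef e ->
  (forall n, psum (fun j => q j * zderiv_seq b j n) (S m) + e n * b n = w ^ n) ->
  germ_solves (inverse_ode w m q (fun n => e n * b n)) (fun z : C => z = 0 \/ z = / w) b.
Proof.
  intros Hw He E z Hz _. destruct (convergence_disc_power_bounded b z Hz) as [r [Hr Hb]].
  cbn [ode_coef ode_order ode_rhs inverse_ode].
  rewrite psum_sum_n, <- (germ_sum_equation w m q e b z Hw He E Hz).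
  apply psum_ext. intros j _.
  rewrite (iter_C_derive b r) by auto. rewrite <- (germ_sum_zderiv_seq j b r) by auto. ring.
Qed.

Lemma inverse_ode_singular (w : C) (m : nat) (q h : nat -> C) : w <> 0 -> entire_coef h ->
  q m <> 0 ->
  ode_singular_points_in (inverse_ode w m q h) (fun z : C => z = 0 \/ z = / w).
Proof.
  intros Hw Hh Hq. split; [|split]; cbn [ode_coef ode_order ode_rhs inverse_ode].
  - intros j _ z _. apply ex_derive_cdiff. apply cdiff_mult. apply cdiff_const.
    apply cdiff_pow. apply cdiff_id.
  - intros z Hz. apply ex_derive_cdiff. apply ode_right_cdiff; auto.
  - intros z Hz. apply Cmult_neq_0; auto. apply Cpow_nz. auto.
Qed.

(** * Analytic continuation of the solutions of Euler systems *)

Definition euler_rhs (A : nat -> nat -> C) (m : nat) (Y : nat -> C) (j : nat) : C :=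
  psum (fun i => A j i * Y i) m.

(** The system [z Y' = A Y + V], solved for the derivatives. *)
Definition euler_sol (A : nat -> nat -> C) (V : nat -> C -> C) (m : nat)
  (Y : nat -> C -> C) (z : C) : Prop :=
  forall j, (j < m)%nat ->
    cder (Y j) z ((euler_rhs A m (fun i => Y i z) j + V j z) / z).

(** The Taylor coefficients at [z0] of the solution with value [y0], when [V] has the
    coefficients [v] there. *)
Fixpoint euler_coef (A : nat -> nat -> C) (v : nat -> nat -> C) (m : nat) (z0 : C)
  (y0 : nat -> C) (n : nat) : nat -> C :=
  match n with
  | O => y0
  | S n => fun j =>
      (euler_rhs A m (euler_coef A v m z0 y0 n) j + v j n
        - INR n * euler_coef A v m z0 y0 n j) / (z0 * INR (S n))
  end.

Definition row_bound (A : nat -> nat -> C) (m : nat) (B : R) : Prop :=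
  forall j (x : nat -> C) (X : R), (j < m)%nat ->
    (forall i, (i < m)%nat -> (Cmod (x i) <= X)%R) -> (Cmod (euler_rhs A m x j) <= B * X)%R.

Lemma uniform_bound (P : nat -> R -> Prop) (m : nat) :
  (forall j M N, P j M -> (M <= N)%R -> P j N) ->
  (forall j, (j < m)%nat -> exists M, P j M) ->
  exists M, (1 <= M)%R /\ forall j, (j < m)%nat -> P j M.
Proof.
  intros Hmon H. induction m.
  - exists 1%R. split. lra. intros; lia.
  - destruct IHm as [M [HM K]]; [intros; apply H; lia|].
    destruct (H m ltac:(lia)) as [N HN].
    exists (Rmax M N). split. eapply Rle_trans; [exact HM|apply Rmax_l].
    intros j Hj. destruct (Nat.eq_dec j m) as [->|n].
    + apply Hmon with N; auto. apply Rmax_r.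
    + apply Hmon with M. apply K. lia. apply Rmax_l.
Qed.

Lemma row_bound_exists (A : nat -> nat -> C) (m : nat) :
  exists B, (1 <= B)%R /\ row_bound A m B.
Proof.
  destruct (uniform_bound (fun j B => forall (x : nat -> C) (X : R),
    (forall i, (i < m)%nat -> (Cmod (x i) <= X)%R) -> (0 <= X)%R ->
    (Cmod (euler_rhs A m x j) <= B * X)%R) m) as [B [HB K]].
  - intros j M N H HMN x X Hx HX. eapply Rle_trans. apply (H x X Hx HX).
    now apply Rmult_le_compat_r.
  - intros j _. unfold euler_rhs. induction m as [|k IHk].
    + exists 0%R. intros x X _ HX. simpl. rewrite Cmod_0. lra.
    + destruct IHk as [B HB]. exists (B + Cmod (A j k))%R. intros x X Hx HX. simpl.
      eapply Rle_trans. apply Cmod_triangle. rewrite Rmult_plus_distr_r.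
      apply Rplus_le_compat. apply HB; auto.
      rewrite Cmod_mult. apply Rmult_le_compat_l. apply Cmod_ge_0. apply Hx. lia.
  - exists B. split; auto. intros j x X Hj Hx. apply K; auto.
    eapply Rle_trans; [|apply (Hx j Hj)]. apply Cmod_ge_0.
Qed.

(** Dividing by [S n] absorbs the factor [n] of the recurrence, so the coefficients
    grow at most geometrically. *)
Lemma euler_coef_power_bounded (A : nat -> nat -> C) (v : nat -> nat -> C) (m : nat) (z0 : C)
  (y0 : nat -> C) (B r : R) : row_bound A m B -> (1 <= B)%R -> z0 <> 0 ->
  (0 < r <= Cmod z0 / (B + 1))%R -> (forall j, (j < m)%nat -> power_bounded (v j) r) ->
  forall j, (j < m)%nat -> power_bounded (fun n => euler_coef A v m z0 y0 n j) r.
Proof.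
  intros HB HB1 Hz Hr Hv.
  assert (Hzm : (0 < Cmod z0)%R) by now apply Cmod_gt_0.
  destruct (uniform_bound (fun j M => (Cmod (y0 j) <= M)%R /\ forall n, (Cmod (v j n) * r ^ n <= M)%R) m)
    as [M [HM K]].
  { intros j M N [H1 H2] HMN. split. lra. intros n. specialize (H2 n). lra. }
  { intros j Hj. destruct (Hv j Hj) as [M HM]. exists (Rmax (Cmod (y0 j)) M). split. apply Rmax_l.
    intros n. eapply Rle_trans. apply HM. apply Rmax_r. }
  assert (G : forall n j, (j < m)%nat -> (Cmod (euler_coef A v m z0 y0 n j) <= M * / r ^ n)%R).
  { induction n; intros j Hj.
    - simpl. rewrite Rinv_1, Rmult_1_r. now apply K.
    - cbn [euler_coef]. set (X := (M * / r ^ n)%R) in *.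
      assert (Hrn : (0 < r ^ n)%R) by (apply pow_lt; lra).
      assert (HX : (0 < X)%R) by (apply Rmult_lt_0_compat; [lra|now apply Rinv_0_lt_compat]).
      assert (Hn : (0 < INR (S n))%R) by (apply lt_0_INR; lia).
      pose proof (pos_INR n) as Hn0.
      assert (Hnc : RtoC (INR (S n)) <> 0) by apply INR_S_neq0.
      rewrite Cmod_div, Cmod_mult, Cmod_INR by now apply Cmult_neq_0.
      apply <- Rle_div_l; [|now apply Rmult_lt_0_compat].
      eapply Rle_trans. apply Cmod_triangle_minus.
      eapply Rle_trans. apply Rplus_le_compat_r. apply Cmod_triangle.
      rewrite Cmod_mult, Cmod_INR.
      assert (H1 := HB j _ X Hj IHn).
      assert (H2 : (Cmod (v j n) <= X)%R). { apply -> Rle_div_r. now apply K. auto. }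
      assert (H3 := IHn j Hj).
      assert (H4 : (X * (B + 1) <= M * / r ^ S n * Cmod z0)%R).
      { replace (M * / r ^ S n * Cmod z0)%R with (X * (Cmod z0 / r))%R.
        - apply Rmult_le_compat_l. lra. apply -> Rle_div_r; [|lra].
          destruct Hr as [_ Hr]. apply <- Rle_div_r in Hr; lra.
        - unfold X. simpl. field. lra. }
      rewrite S_INR in *.
      apply Rle_trans with (X * (B + 1) * (INR n + 1))%R.
      + assert (INR n * Cmod (euler_coef A v m z0 y0 n j) <= INR n * X)%R by now apply Rmult_le_compat_l.
        assert (0 <= X * (B * INR n))%R. { apply Rmult_le_pos. lra. apply Rmult_le_pos; lra. }
        nra.
      + rewrite <- Rmult_assoc. apply Rmult_le_compat_r; lra. }
  intros j Hj. exists M. intros n.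
  assert (Hrn : (0 < r ^ n)%R) by (apply pow_lt; lra).
  apply Rle_trans with (M * / r ^ n * r ^ n)%R.
  apply Rmult_le_compat_r. lra. now apply G. right. field. lra.
Qed.

Lemma euler_rhs_germ_sum (A : nat -> nat -> C) (m j : nat) (c : nat -> nat -> C) (r : R) (x : C) :
  (Cmod x < r)%R -> (forall i, (i < m)%nat -> power_bounded (c i) r) ->
  germ_sum (fun n => euler_rhs A m (fun i => c i n) j) x
    = euler_rhs A m (fun i => germ_sum (c i) x) j.
Proof. intros Hx Hc. unfold euler_rhs. now apply germ_sum_psum with r. Qed.

(** Writing [z = z0 + x] with [x = z - z0], the product of [x] and the derivative is
    [germ_sum (theta_seq c) x]. *)
Lemma germ_sum_euler_operator (c : nat -> C) (z0 z : C) (r : R) : power_bounded c r ->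
  (Cmod (z - z0) < r)%R ->
  z * germ_sum (deriv_seq c) (z - z0) = germ_sum (fun n => z0 * deriv_seq c n + theta_seq c n) (z - z0).
Proof.
  intros Hc Hz. pose proof (Cmod_ge_0 (z - z0)).
  set (s := ((Cmod (z - z0) + r) / 2)%R). assert (Hs : (Cmod (z - z0) < s < r)%R) by (unfold s; lra).
  assert (Hd : power_bounded (deriv_seq c) s) by (apply power_bounded_deriv_seq with r; auto; lra).
  assert (Hn : power_bounded (theta_seq c) s) by (apply power_bounded_theta_seq with r; auto; lra).
  rewrite (germ_sum_plus (fun n => z0 * deriv_seq c n) (theta_seq c) s), (germ_sum_scal z0 (deriv_seq c) s); auto; try lra.
  2: now apply power_bounded_scal.
  rewrite <- (germ_sum_theta c r) by auto. ring.
Qed.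

Lemma euler_local_solution (A : nat -> nat -> C) (v : nat -> nat -> C) (m : nat) (z0 : C)
  (y0 : nat -> C) (B r : R) : row_bound A m B -> (1 <= B)%R -> z0 <> 0 ->
  (0 < r <= Cmod z0 / (B + 1))%R -> (forall j, (j < m)%nat -> power_bounded (v j) r) ->
  exists Y : nat -> C -> C, (forall j, Y j z0 = y0 j) /\
    forall z, (Cmod (z - z0) < r)%R -> euler_sol A (fun j z => germ_sum (v j) (z - z0)) m Y z.
Proof.
  intros HB HB1 Hz0 Hr Hv.
  pose proof (euler_coef_power_bounded A v m z0 y0 B r HB HB1 Hz0 Hr Hv) as Hbd.
  set (c := fun j n => euler_coef A v m z0 y0 n j).
  assert (Hbd' : forall j, (j < m)%nat -> power_bounded (c j) r) by exact Hbd.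
  exists (fun j z => germ_sum (c j) (z - z0)). split.
  - intros j. replace (z0 - z0) with (RtoC 0) by ring. rewrite germ_sum_0. reflexivity.
  - intros z Hz j Hj.
    assert (Hz' : z <> 0).
    { intros ->. replace (0 - z0) with (- z0) in Hz by ring. rewrite Cmod_opp in Hz.
      assert (Cmod z0 / (B + 1) <= Cmod z0)%R; [|lra].
      apply <- Rle_div_l; [|lra]. pose proof (Cmod_ge_0 z0). nra. }
    eapply cder_eq. apply (cder_shift (germ_sum (c j))). apply germ_sum_cder with r; auto.
    replace (germ_sum (deriv_seq (c j)) (z - z0)) with (z * germ_sum (deriv_seq (c j)) (z - z0) / z) by now field.
    f_equal. rewrite (germ_sum_euler_operator (c j) z0 z r) by auto.
    rewrite <- (euler_rhs_germ_sum A m j c r) by auto.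
    rewrite <- (germ_sum_plus _ (v j) r); auto.
    + apply germ_sum_ext. intros n. unfold deriv_seq, theta_seq, c. cbn [euler_coef].
      change (fun i => euler_coef A v m z0 y0 n i) with (euler_coef A v m z0 y0 n).
      pose proof (INR_S_neq0 n). field. auto.
    + apply power_bounded_psum; auto. lra.
Qed.

(** Near [z0] the components of the difference are sums of power series. Their
    coefficients satisfy the homogeneous recurrence, which propagates the vanishing of the
    constant terms. *)
Lemma euler_unique (A : nat -> nat -> C) (V : nat -> C -> C) (m : nat) (Y Z : nat -> C -> C)
  (z0 : C) :
  z0 <> 0 -> near z0 (euler_sol A V m Y) -> near z0 (euler_sol A V m Z) ->
  (forall j, (j < m)%nat -> Y j z0 = Z j z0) ->
  near z0 (fun z => forall j, (j < m)%nat -> Y j z = Z j z).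
Proof.
  intros Hz0 HY HZ H0.
  destruct (near_and _ _ _ (near_neq _ _ Hz0) (near_and _ _ _ HY HZ)) as [d [Hd K]].
  set (r := (d / 2)%R). assert (Hr : (0 < r)%R) by (unfold r; lra).
  assert (HD : forall j, exists c, (j < m)%nat -> power_bounded c r /\
    forall z, (Cmod (z - z0) < r)%R -> Y j z - Z j z = germ_sum c (z - z0)).
  { intros j. destruct (classic (j < m)%nat) as [Hj|Hj]; [|exists (fun _ => RtoC 0); tauto].
    destruct (power_series_disc (fun z => Y j z - Z j z) z0 r Hr) as [c Hc].
    - intros z Hz. destruct (K z) as [_ [K1 K2]]. unfold r in Hz. lra.
      apply cdiff_minus; eexists; [now apply K1|now apply K2].
    - exists c. auto. }
  set (c := fun j => proj1_sig (constructive_indefinite_description _ (HD j))).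
  assert (Hc : forall j, (j < m)%nat -> power_bounded (c j) r /\
    forall z, (Cmod (z - z0) < r)%R -> Y j z - Z j z = germ_sum (c j) (z - z0)).
  { intros j. unfold c. destruct (constructive_indefinite_description _ (HD j)). auto. }
  clearbody c. clear HD.
  assert (rec : forall j, (j < m)%nat -> forall n,
    z0 * deriv_seq (c j) n + theta_seq (c j) n = euler_rhs A m (fun i => c i n) j).
  { intros j Hj. destruct (Hc j Hj) as [Hbd Heq].
    apply (germ_sum_identity _ (fun n => euler_rhs A m (fun i => c i n) j) (r / 2)).
    - lra.
    - apply power_bounded_plus. lra. apply power_bounded_scal. apply power_bounded_deriv_seq with r; auto; lra. apply power_bounded_theta_seq with r; auto; lra.
    - apply power_bounded_psum. lra. intros i Hi. apply power_bounded_le with r. lra. now apply Hc.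
    - exists r. split; auto. intros x Hx. replace (x - 0) with x in Hx by ring.
      set (z := x + z0). assert (Hxz : x = z - z0) by (unfold z; ring).
      rewrite Hxz in Hx |- *.
      rewrite <- (germ_sum_euler_operator (c j) z0 z r) by auto.
      rewrite (euler_rhs_germ_sum A m j c r) by (auto; intros i Hi; now apply Hc).
      destruct (K z) as [Hz [K1 K2]]. unfold r in Hx. lra.
      assert (E1 : cder (fun y => Y j y - Z j y) z (germ_sum (deriv_seq (c j)) (z - z0))).
      { apply cder_ext_near with (fun y => germ_sum (c j) (y - z0)).
        - apply near_imp with (2 := near_ball _ _ _ Hx). intros y Hy. symmetry. now apply Heq.
        - apply cder_shift. now apply germ_sum_cder with r. }
      assert (E2 := cder_minus _ _ _ _ _ (K1 j Hj) (K2 j Hj)).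
      apply C_derive_cder in E1, E2. rewrite <- E1, E2.
      transitivity (euler_rhs A m (fun i => Y i z) j - euler_rhs A m (fun i => Z i z) j).
      + field. exact Hz.
      + unfold euler_rhs.
        rewrite (psum_ext (fun i => A j i * germ_sum (c i) (z - z0))
          (fun i => A j i * Y i z + - (1) * (A j i * Z i z))).
        * rewrite psum_plus, psum_scal. ring.
        * intros i Hi. rewrite <- (proj2 (Hc i Hi)) by auto. ring. }
  assert (zero : forall n j, (j < m)%nat -> c j n = 0).
  { induction n; intros j Hj.
    - rewrite <- germ_sum_0. replace (RtoC 0) with (z0 - z0) at 1 by ring.
      rewrite <- (proj2 (Hc j Hj)). rewrite H0 by auto. ring.
      replace (z0 - z0) with (RtoC 0) by ring. now rewrite Cmod_0.
    - pose proof (rec j Hj n) as E. unfold deriv_seq, theta_seq, euler_rhs in E.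
      rewrite (psum_0 (fun i => A j i * c i n)) in E.
      2: { intros i Hi. rewrite IHn by auto. ring. }
      rewrite IHn in E by auto. pose proof (INR_S_neq0 n).
      replace (c j (S n)) with ((z0 * (INR (S n) * c j (S n)) + INR n * 0) / (z0 * INR (S n)))
        by (field; auto).
      rewrite E. field. auto. }
  exists r. split; auto. intros z Hz j Hj. apply Cminus_eq0.
  rewrite (proj2 (Hc j Hj)) by auto. apply germ_sum_eq.
  apply is_Cseries_lim with (fun _ => 0%R). 2: apply is_lim_seq_const.
  intros n. rewrite psum_0. replace (0 - 0) with (RtoC 0) by ring. rewrite Cmod_0; lra.
  intros k _. rewrite zero by auto. ring.
Qed.

Definition euler_germ (A : nat -> nat -> C) (V : nat -> C -> C) (m : nat) (f : C -> C) (z : C) : Prop :=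
  exists Y : nat -> C -> C, near z (fun y => f y = Y 0%nat y) /\ near z (euler_sol A V m Y).

(** Around [y] the system has a solution with the value of the given one at [y], and the
    two coincide near [y]. The radius of existence at [y] is proportional to the distance
    from [y] to [0] and [p], so near [z] it has a positive lower bound. *)
Lemma euler_germ_extension (A : nat -> nat -> C) (V : nat -> C -> C) (m : nat) (p : C) :
  (forall j z, z <> p -> cdiff (V j) z) -> (0 < m)%nat ->
  forall z : C, ~ (z = 0 \/ z = p) -> exists d, (0 < d)%R /\
    forall y f, (Cmod (y - z) < d)%R -> euler_germ A V m f y ->
      exists g, (forall x, (Cmod (x - z) < d)%R -> euler_germ A V m g x) /\
        near y (fun x => f x = g x).
Proof.
  intros HV Hm z Hz.
  assert (Hz1 : (0 < Cmod z)%R) by (apply Cmod_gt_0; tauto).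
  assert (Hz2 : (0 < Cmod (z - p))%R) by (apply Cmod_gt_0, Cminus_neq0; tauto).
  destruct (row_bound_exists A m) as [B [HB1 HB]].
  set (d0 := Rmin (Cmod z) (Cmod (z - p))).
  assert (Hd0 : (0 < d0)%R) by now apply Rmin_glb_lt.
  (* the constant is chosen so that [d0 - d = 2 * d * (B + 1)] *)
  set (d := (d0 / (2 * B + 3))%R).
  assert (Hd : (0 < d)%R) by (apply Rdiv_lt_0_compat; lra).
  assert (Hdd : (d0 - d = 2 * d * (B + 1))%R) by (unfold d; field; lra).
  exists d. split; auto. intros y f Hy [Y [HfY HY]].
  assert (Hy1 : (d0 - d < Cmod y)%R).
  { pose proof (Cmod_rev z (z - y)). replace (z - (z - y)) with y in H by ring.
    rewrite (Cmod_minus_sym z y) in H. assert (d0 <= Cmod z)%R by apply Rmin_l. lra. }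
  assert (Hy2 : (d0 - d < Cmod (y - p))%R).
  { pose proof (Cmod_rev (z - p) (z - y)). replace (z - p - (z - y)) with (y - p) in H by ring.
    rewrite (Cmod_minus_sym z y) in H. assert (d0 <= Cmod (z - p))%R by apply Rmin_r. lra. }
  assert (Hy0 : y <> 0) by (apply Cmod_gt_0; nra).
  set (r := (2 * d)%R).
  assert (Hr : (2 * r <= d0 - d)%R) by (unfold r; nra).
  assert (HVs : forall j, exists v, power_bounded v r /\
    forall x, (Cmod (x - y) < r)%R -> V j x = germ_sum v (x - y)).
  { intros j. apply power_series_disc. unfold r; lra. intros x Hx. apply HV. intros ->.
    rewrite Cmod_minus_sym in Hx. lra. }
  set (v := fun j => proj1_sig (constructive_indefinite_description _ (HVs j))).
  assert (Hv : forall j, power_bounded (v j) r /\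
    forall x, (Cmod (x - y) < r)%R -> V j x = germ_sum (v j) (x - y)).
  { intros j. unfold v. now destruct (constructive_indefinite_description _ (HVs j)). }
  clearbody v. clear HVs.
  destruct (euler_local_solution A v m y (fun j => Y j y) B r HB HB1 Hy0) as [Z [HZ0 HZ]].
  { split. unfold r; lra. apply -> Rle_div_r; [|lra]. unfold r. lra. }
  { intros j _. apply Hv. }
  assert (HZ' : forall x, (Cmod (x - y) < r)%R -> euler_sol A V m Z x).
  { intros x Hx j Hj. rewrite (proj2 (Hv j) x Hx). now apply HZ. }
  exists (Z 0%nat). split.
  - intros x Hx. exists Z. split. exists 1%R; split; auto; lra.
    assert (Hxy : (Cmod (x - y) < r)%R).
    { replace (x - y) with ((x - z) - (y - z)) by ring.
      eapply Rle_lt_trans. apply Cmod_triangle_minus. unfold r. lra. }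
    apply near_imp with (2 := near_ball _ _ _ Hxy). exact HZ'.
  - assert (HZn : near y (euler_sol A V m Z)). { exists r. split. unfold r; lra. exact HZ'. }
    apply near_imp with (2 := near_and _ _ _ HfY
      (euler_unique A V m Y Z y Hy0 HY HZn (fun j _ => eq_sym (HZ0 j)))).
    intros x [-> Hx]. now apply Hx.
Qed.

Lemma euler_germ_cdiff (A : nat -> nat -> C) (V : nat -> C -> C) (m : nat) (f : C -> C) (z : C) :
  (0 < m)%nat -> euler_germ A V m f z -> near z (cdiff f).
Proof.
  intros Hm [Y [H1 H2]]. apply near_near in H1.
  apply near_imp with (2 := near_and _ _ _ H1 H2). intros y [K1 K2].
  apply cdiff_ext_near with (Y 0%nat). apply near_imp with (2 := K1). congruence.
  eexists. now apply K2.
Qed.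

(** For any class of germs that extend to discs of locally uniform radius: by the
    extension around [gamma T], where [T] is the supremum of the parameters that can be
    reached, a continuation that comes close enough to [T] goes beyond it, unless [T] is
    the end of the path. *)
Lemma continuation_along_path (Sing : C -> Prop) (Sol : (C -> C) -> C -> Prop) (gamma : R -> C)
  (f0 : C -> C) :
  (forall z, ~ Sing z -> exists d, (0 < d)%R /\
     forall y f, (Cmod (y - z) < d)%R -> Sol f y ->
       exists g, (forall x, (Cmod (x - z) < d)%R -> Sol g x) /\ near y (fun x => f x = g x)) ->
  (forall t, unit_interval t -> forall eps, (0 < eps)%R -> exists eta, (0 < eta)%R /\
     forall s, unit_interval s -> (Rabs (s - t) < eta)%R -> (Cmod (gamma s - gamma t) < eps)%R) ->
  (forall t, unit_interval t -> ~ Sing (gamma t)) ->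
  Sol f0 (gamma 0%R) ->
  exists phi : R -> C -> C, phi 0%R = f0 /\
    (forall t, unit_interval t -> Sol (phi t) (gamma t)) /\
    (forall t, unit_interval t -> exists eta, (0 < eta)%R /\
       forall s, unit_interval s -> (Rabs (s - t) < eta)%R ->
         near (gamma s) (fun z => phi s z = phi t z)).
Proof.
  intros Hext Hcont Havoid H0. unfold unit_interval in *.
  set (Claim := fun T : R => exists phi : R -> C -> C, phi 0%R = f0 /\
    (forall t, (0 <= t <= T)%R -> Sol (phi t) (gamma t)) /\
    (forall t, (0 <= t <= T)%R -> exists eta, (0 < eta)%R /\
       forall s, (0 <= s <= T)%R -> (Rabs (s - t) < eta)%R ->
         near (gamma s) (fun z => phi s z = phi t z))).
  assert (Hrefl : forall z (f : C -> C), near z (fun x => f x = f x)).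
  { intros z f. exists 1%R. split. lra. auto. }
  assert (C0 : Claim 0%R).
  { exists (fun _ => f0). split; [auto|split].
    - intros t Ht. replace t with 0%R by lra. exact H0.
    - intros t Ht. exists 1%R. split. lra. intros; apply Hrefl. }
  assert (step : forall z d t1 t2, (0 <= t1 <= t2)%R -> (t2 <= 1)%R ->
    (forall y f, (Cmod (y - z) < d)%R -> Sol f y ->
       exists g, (forall x, (Cmod (x - z) < d)%R -> Sol g x) /\ near y (fun x => f x = g x)) ->
    (forall s, (t1 <= s <= t2)%R -> (Cmod (gamma s - z) < d)%R) ->
    Claim t1 -> Claim t2).
  { intros z d t1 t2 Ht Ht2 Hd Hg [phi [P0 [P1 P2]]].
    destruct (Hd (gamma t1) (phi t1)) as [g [G1 G2]].
    { apply Hg. lra. } { apply P1. lra. }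
    exists (fun s => if Rle_dec s t1 then phi s else g). split; [|split].
    - destruct (Rle_dec 0 t1); auto. lra.
    - intros t Htt. destruct (Rle_dec t t1). apply P1; lra. apply G1. apply Hg. lra.
    - intros t Htt. destruct (Rtotal_order t t1) as [Hlt|[->|Hgt]].
      + destruct (P2 t ltac:(lra)) as [eta [He K]].
        exists (Rmin eta (t1 - t)). split. apply Rmin_glb_lt; lra.
        intros s Hs Hst.
        assert (Hs1 : (Rabs (s - t) < t1 - t)%R) by (eapply Rlt_le_trans; [exact Hst|apply Rmin_r]).
        pose proof (Rle_abs (s - t)).
        destruct (Rle_dec s t1); [|lra]. destruct (Rle_dec t t1); [|lra].
        apply K. lra. eapply Rlt_le_trans; [exact Hst|apply Rmin_l].
      + destruct (P2 t1 ltac:(lra)) as [eta [He K]].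
        destruct (near_near _ _ G2) as [e [He' KG]].
        destruct (Hcont t1 ltac:(lra) e He') as [eta' [Heta' KC]].
        exists (Rmin eta eta'). split. apply Rmin_glb_lt; lra.
        intros s Hs Hst. destruct (Rle_dec t1 t1); [|lra].
        destruct (Rle_dec s t1).
        * apply K. lra. eapply Rlt_le_trans; [exact Hst|apply Rmin_l].
        * assert (Hn : near (gamma s) (fun x => phi t1 x = g x)).
          { apply KG. apply KC. lra. eapply Rlt_le_trans; [exact Hst|apply Rmin_r]. }
          apply near_imp with (2 := Hn). auto.
      + exists (t - t1)%R. split. lra. intros s Hs Hst.
        pose proof (Rle_abs (t - s)). rewrite Rabs_minus_sym in Hst.
        destruct (Rle_dec s t1); [lra|]. destruct (Rle_dec t t1); [lra|]. apply Hrefl. }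
  enough (H1 : Claim 1%R) by exact H1.
  destruct (completeness (fun T => (0 <= T <= 1)%R /\ Claim T)) as [T [U L]].
  - exists 1%R. intros T [HT _]. lra.
  - exists 0%R. split. lra. exact C0.
  - assert (HT : (0 <= T <= 1)%R).
    { split. apply U. split. lra. exact C0. apply L. intros x [Hx _]. lra. }
    destruct (Hext (gamma T) (Havoid T HT)) as [d [Hd Kd]].
    destruct (Hcont T HT d Hd) as [eta [He Kc]].
    assert (Hx : exists t1, (T - eta < t1 <= T)%R /\ (0 <= t1)%R /\ Claim t1).
    { apply NNPP. intros N. assert (T <= T - eta)%R; [|lra]. apply L. intros x [Hx Cx].
      apply Rnot_lt_le. intros Hlt. apply N. exists x. repeat split; auto; lra. }
    destruct Hx as (t1 & Ht1 & Ht10 & Ct1).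
    set (t2 := Rmin 1 (T + eta / 2)).
    assert (Ht2 : (T <= t2)%R) by (apply Rmin_glb; lra).
    assert (Ht21 : (t2 <= 1)%R) by apply Rmin_l.
    assert (Ht2e : (t2 <= T + eta / 2)%R) by apply Rmin_r.
    assert (Ct2 : Claim t2).
    { apply (step (gamma T) d t1 t2); auto; try lra.
      intros s Hs. apply Kc. lra. apply Rabs_lt_between. lra. }
    assert (t2 <= T)%R by (apply U; split; [lra|exact Ct2]).
    assert (t2 = 1)%R. { unfold t2, Rmin in *. destruct (Rle_dec 1 (T + eta / 2)); lra. }
    congruence.
Qed.

Lemma psum_delta (k : nat) (x : C) (Y : nat -> C) (m : nat) : (k < m)%nat ->
  psum (fun i => (if Nat.eq_dec i k then x else 0) * Y i) m = x * Y k.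
Proof.
  intros Hk. induction m. lia. simpl. destruct (Nat.eq_dec m k) as [->|n].
  - rewrite psum_0. ring. intros i Hi. destruct (Nat.eq_dec i k). lia. ring.
  - rewrite IHm by lia. ring.
Qed.

(** The system satisfied by the functions [z ^ j * G^(j)], [j < m], when
    [sum_(j <= m) q j * z ^ j * G^(j) = R]. *)
Definition companion (q : nat -> C) (m j i : nat) : C :=
  (if Nat.eq_dec i j then RtoC (INR j) else 0) +
  (if Nat.eq_dec (S j) m then - (q i / q m) else if Nat.eq_dec i (S j) then 1 else 0).

Definition companion_source (q : nat -> C) (m : nat) (R : C -> C) (j : nat) (z : C) : C :=
  if Nat.eq_dec (S j) m then R z / q m else 0.

Lemma companion_rhs (q : nat -> C) (m j : nat) (Y : nat -> C) (z : C) (Rz : C -> C) :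
  (j < m)%nat -> q m <> 0 -> psum (fun j => q j * Y j) (S m) = Rz z ->
  euler_rhs (companion q m) m Y j + companion_source q m Rz j z = INR j * Y j + Y (S j).
Proof.
  intros Hj Hq E. unfold euler_rhs, companion, companion_source.
  rewrite (psum_ext _ (fun i => (if Nat.eq_dec i j then RtoC (INR j) else 0) * Y i +
    (if Nat.eq_dec (S j) m then - (q i / q m) else if Nat.eq_dec i (S j) then 1 else 0) * Y i))
    by (intros; ring).
  rewrite psum_plus, psum_delta by auto.
  destruct (Nat.eq_dec (S j) m) as [->|n].
  - rewrite <- E. cbn [psum].
    rewrite (psum_ext _ (fun i => - / q m * (q i * Y i))) by (intros; field; auto).
    rewrite psum_scal. field. auto.
  - rewrite psum_delta by lia. ring.
Qed.

Lemma convergence_disc_near (b : nat -> C) (z : C) : convergence_disc b z ->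
  near z (convergence_disc b).
Proof.
  intros Hz. destruct (convergence_disc_power_bounded b z Hz) as [r [Hr Hb]]. pose proof (Cmod_ge_0 z).
  apply near_imp with (2 := near_ball 0 z r ltac:(now replace (z - 0) with z by ring)).
  intros y Hy. apply power_bounded_convergence_disc with r; auto. lra. now replace (y - 0) with y in Hy by ring.
Qed.

Lemma germ_euler_sol (b : nat -> C) (q : nat -> C) (m : nat) (R : C -> C) (z : C) : q m <> 0 ->
  z <> 0 ->
  convergence_disc b z -> psum (fun j => q j * germ_sum (zderiv_seq b j) z) (S m) = R z ->
  euler_sol (companion q m) (companion_source q m R) m (fun j => germ_sum (zderiv_seq b j)) z.
Proof.
  intros Hq Hz Hb E j Hj. pose proof (Cmod_ge_0 z).
  destruct (convergence_disc_power_bounded b z Hb) as [r [Hr Hbd]].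
  set (s := ((Cmod z + r) / 2)%R). assert (Hs : (Cmod z < s < r)%R) by (unfold s; lra).
  assert (Hf : forall j, power_bounded (zderiv_seq b j) s) by (intros; apply power_bounded_zderiv_seq with r; auto; lra).
  eapply cder_eq. apply germ_sum_cder with s; auto. lra.
  rewrite (companion_rhs q m j (fun i => germ_sum (zderiv_seq b i) z) z R) by auto.
  replace (germ_sum (deriv_seq (zderiv_seq b j)) z) with (z * germ_sum (deriv_seq (zderiv_seq b j)) z / z) by now field.
  f_equal. rewrite (germ_sum_theta _ s) by (auto; lra).
  rewrite (germ_sum_ext _ _ z (zderiv_seq_theta b j)).
  rewrite (germ_sum_plus (fun n => INR j * zderiv_seq b j n) (zderiv_seq b (S j)) s); auto; try lra.
  rewrite (germ_sum_scal _ _ s); auto. lra. now apply power_bounded_scal.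
Qed.

Lemma singular_pair_closed_discrete (w : C) : nonempty_closed_discrete (fun z : C => z = 0 \/ z = / w).
Proof.
  split; [|split].
  - exists 0. now left.
  - intros z Hz. apply NNPP. intros N. apply Hz. apply near_locally.
    apply near_imp with (2 := near_and _ _ _ (near_neq z 0 ltac:(tauto)) (near_neq z (/ w) ltac:(tauto))).
    intros y; tauto.
  - assert (K : forall z p : C, near z (fun y => y <> z -> y <> p)).
    { intros z p. destruct (Ceq_dec z p) as [->|n].
      - exists 1%R. split. lra. auto.
      - apply near_imp with (2 := near_neq _ _ n). auto. }
    intros z _. apply near_locally.
    apply near_imp with (2 := near_and _ _ _ (K z 0) (K z (/ w))).
    intros y [H1 H2] Hy [ -> | -> ]; [now apply H1|now apply H2].
Qed.

(** The continuation starts from [germ_sum b] at the beginning of the path. The case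
    [m = 0], where the system has no component, is separate. *)
Lemma germ_continuable (w : C) (m : nat) (q e b : nat -> C) : w <> 0 -> entire_coef e -> q m <> 0 ->
  convergent_germ b ->
  (forall n, psum (fun j => q j * zderiv_seq b j n) (S m) + e n * b n = w ^ n) ->
  continuable (fun z : C => z = 0 \/ z = / w) b.
Proof.
  intros Hw He Hq Hb E. split; [apply singular_pair_closed_discrete|split; [auto|]].
  intros gamma Hcont Havoid Hstart.
  assert (Hc : forall t, unit_interval t -> forall eps, (0 < eps)%R -> exists eta, (0 < eta)%R /\
     forall s, unit_interval s -> (Rabs (s - t) < eta)%R -> (Cmod (gamma s - gamma t) < eps)%R).
  { intros t Ht eps Heps.
    assert (Hn : near (gamma t) (fun y => (Cmod (y - gamma t) < eps)%R)) by (exists eps; auto).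
    apply near_locally in Hn. specialize (Hcont t Ht _ Hn). destruct Hcont as [eta K].
    exists (pos eta). split. apply cond_pos. intros s Hs Hst. now apply K. }
  set (h := fun n => e n * b n).
  assert (Hh : entire_coef h).
  { destruct (convergent_germ_power_bounded b Hb) as [r [Hr Hbd]]. now apply entire_coef_mult with r. }
  set (R := ode_right w h).
  assert (HR : forall z, z <> / w -> cdiff R z) by (intros; now apply ode_right_cdiff).
  assert (Heq : forall z, convergence_disc b z -> psum (fun j => q j * germ_sum (zderiv_seq b j) z) (S m) = R z).
  { intros z Hz. now apply germ_sum_equation. }
  assert (Hfall0 : forall z, germ_sum (zderiv_seq b 0) z = germ_sum b z).
  { intros z. apply germ_sum_ext. intros n. unfold zderiv_seq. simpl. ring. }
  destruct m as [|m].
  - exists (fun _ z => R z / q 0%nat). split; [|split].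
    + intros t Ht. apply near_locally.
      apply near_imp with (2 := near_neq (gamma t) (/ w) ltac:(specialize (Havoid t Ht); tauto)).
      intros y Hy. apply ex_derive_cdiff. apply cdiff_div; auto. apply cdiff_const.
    + apply near_locally. apply near_imp with (2 := convergence_disc_near b _ Hstart).
      intros y Hy. rewrite <- (Heq y Hy). cbn [psum]. rewrite Hfall0. field. auto.
    + intros t Ht. exists (mkposreal 1 Rlt_0_1). intros s _ _. apply near_locally. exists 1%R. split. lra. auto.
  - set (A := companion q (S m)). set (V := companion_source q (S m) R).
    assert (H0 : gamma 0%R <> 0).
    { intros E0. apply (Havoid 0%R). unfold unit_interval; lra. now left. }
    destruct (continuation_along_path (fun z => z = 0 \/ z = / w) (euler_germ A V (S m)) gamma (germ_sum b))
      as [phi [P0 [P1 P2]]]; auto.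
    + apply euler_germ_extension; [|lia]. intros j z Hz. unfold V, companion_source.
      destruct (Nat.eq_dec (S j) (S m)). apply cdiff_div; auto. apply cdiff_const. apply cdiff_const.
    + exists (fun j => germ_sum (zderiv_seq b j)). split.
      * exists 1%R. split. lra. intros y _. now rewrite Hfall0.
      * apply near_imp with (2 := near_and _ _ _ (convergence_disc_near b _ Hstart) (near_neq _ _ H0)).
        intros y [Hy Hy0]. apply germ_euler_sol; auto.
    + exists phi. split; [|split].
      * intros t Ht. apply near_locally. apply near_imp with (Q := fun y => @ex_derive C_AbsRing C_NormedModule (phi t) y)
          (2 := euler_germ_cdiff _ _ _ _ _ (Nat.lt_0_succ m) (P1 t Ht)).
        intros y Hy. now apply ex_derive_cdiff.
      * apply near_locally. rewrite P0. exists 1%R. split. lra. auto.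
      * intros t Ht. destruct (P2 t Ht) as [eta [Heta K]]. exists (mkposreal eta Heta).
        intros s Hs Hsu. apply near_locally. now apply K.
Qed.

Theorem theorem1 (w : C) (F : C -> C) (a b : nat -> C)
  (hw : w <> 0)
  (hF : meromorphic F)
  (hpole : pole F w)
  (honly : forall z : C, pole F z -> z = w)
  (ha : germ_of F a)
  (hb : hadamard_inverse a b) :
  let Sing := fun z : C => z = 0 \/ z = / w in
  (exists E : linear_ode,
     ode_singular_points_in E Sing /\ ode_nonhomogeneous E Sing /\ germ_solves E Sing b) /\
  continuable Sing b /\
  resurgent b.
Proof.
  intros Sing. destruct (hadamard_inverse_coefficients w F a b hw hF hpole honly ha hb)
    as (m & q & e & He & Hq & E).
  destruct hb as [Hb _].
  assert (Hh : entire_coef (fun n => e n * b n)).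
  { destruct (convergent_germ_power_bounded b Hb) as [r [Hr Hbd]]. now apply entire_coef_mult with r. }
  pose proof (germ_continuable w m q e b hw He Hq Hb E) as Hcont.
  split; [|split; [exact Hcont|now exists Sing]].
  exists (inverse_ode w m q (fun n => e n * b n)). split; [|split].
  - now apply inverse_ode_singular.
  - now apply ode_right_neq0.
  - now apply inverse_ode_solves.
Qed.
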